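(* Let $h:\Delta\times\overline{\mathbb C}\to\overline{\mathbb C}$ be a normalized holomorphic motion of $\overline{\mathbb C}$ parametrized by $\Delta$ with base point $0$, and let $V$ be its tangent vector at $c=0$, $$V(z)=\lim_{c\to0}\frac{h(c,z)-z}{c},\qquad z\in\mathbb C.$$ For every $R>0$ there exists a number $C$ depending on $R$ such that for every $0<\delta<1$ and any two distinct complex numbers $z_1,z_2$ with $|z_1|<R$, $|z_2|<R$ and $|z_1-z_2|<\delta$, $$|V(z_2)-V(z_1)|\le |z_2-z_1|\left(2+\frac{C}{\log\frac1\delta}\right)\log\frac1{|z_2-z_1|}.$$
   Context: $\overline{\mathbb C}$ is the Riemann sphere and $\Delta=\{c\in\mathbb C:|c|<1\}$. A map $h:\Delta\times E\to\overline{\mathbb C}$, $E\subset\overline{\mathbb C}$, is a holomorphic motion of $E$ parametrized by $\Delta$ with base point $0$ if: (1) $h(0,z)=z$ for all $z\in E$; (2) for every $c\in\Delta$, $z\mapsto h(c,z)$ is injective on $E$; (3) for every $z\in E$, $c\mapsto h(c,z)$ is holomorphic on $\Delta$ (as a map into the Riemann sphere). It is normalized if $h(c,0)=0$, $h(c,1)=1$ and $h(c,\infty)=\infty$ for all $c\in\Delta$. *)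

(* Defs.v *)
From Stdlib Require Import Reals.
From Coquelicot Require Import Coquelicot.

Open Scope R_scope.

(* The Riemann sphere; [None] is the point at infinity. *)
Definition sphere : Type := option C.

Definition infty : sphere := None.

(* The affine coordinate, with junk value 0 at infinity. *)
Definition affine (p : sphere) : C :=
  match p with Some z => z | None => RtoC 0 end.

Definition unit_disk (c : C) : Prop := Cmod c < 1.

(* The two standard charts, given as parametrizations C -> sphere:
   w |-> w, and w |-> 1/w with 0 |-> infinity.  Their transition map w |-> 1/w
   is holomorphic, which gives the complex structure of the sphere. *)
Definition chart_zero (w : C) : sphere := Some w.

Definition chart_infty (w : C) : sphere :=
  if Ceq_dec w (RtoC 0) then infty else Some (Cinv w).

(* Near [c], the map [f] lands in one of the charts, and is complex
   differentiable at [c] in the coordinate of that chart. *)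
Definition sphere_differentiable (f : C -> sphere) (c : C) : Prop :=
  exists chart : C -> sphere, (chart = chart_zero \/ chart = chart_infty) /\
  exists g : C -> C,
    locally c (fun u => f u = chart (g u)) /\
    @ex_derive C_AbsRing C_NormedModule g c.

Definition holomorphic_on_disk (f : C -> sphere) : Prop :=
  forall c : C, unit_disk c -> sphere_differentiable f c.

(* [h c z] is only meaningful for [c] in the unit disk and [z] in [E]. *)
Definition holomorphic_motion (E : sphere -> Prop) (h : C -> sphere -> sphere)
  : Prop :=
  (forall z, E z -> h (RtoC 0) z = z) /\
  (forall c, unit_disk c ->
     forall z w, E z -> E w -> h c z = h c w -> z = w) /\
  (forall z, E z -> holomorphic_on_disk (fun c => h c z)).

Definition normalized (h : C -> sphere -> sphere) : Prop :=
  forall c, unit_disk c ->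
    h c (Some (RtoC 0)) = Some (RtoC 0) /\
    h c (Some (RtoC 1)) = Some (RtoC 1) /\
    h c infty = infty.

(* For a normalized motion of the whole sphere, [h c (Some z)] is never
   infinity (by injectivity), so the junk value of [affine] is not used. *)
Definition tangent_vector (h : C -> sphere -> sphere) (V : C -> C) : Prop :=
  forall z : C,
    filterlim (fun c : C => ((affine (h c (Some z)) - z) / c)%C)
      (locally' (RtoC 0)) (locally (V z)).

(* Main.v *)
(* The cross-ratio g(c) of h(c,z1), h(c,z2), h(c,w) and infinity is a holomorphic
   function of c in the unit disk omitting 0 and 1, with g(0) = (z2 - z1)/(w - z1)
   for a fixed far away point w.  A Landau theorem with sharp leading constant,
   |g'(0)| <= 2 |a| (log (1/|a|) + 64) for a = g(0), |a| <= 1, gives the main term;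
   the other terms involve V(w) and V(z1), bounded by a crude Landau theorem.

   Both Landau theorems come from Ahlfors' lemma.  Robinson's explicit metric on
   C minus {0,1} gives the crude one.  For the sharp one, the maximum of
   sigma(g) |g'| (r^2 - |c|^2), with sigma the hyperbolic density of the disk
   |w| < e^64 punctured at 0, is taken over the set |g| <= 1 only, where the crude
   estimate controls it on the boundary |g| = 1. *)

Require Import Defs.
From Stdlib Require Import Reals Lra Lia ClassicalEpsilon.
From Coquelicot Require Import Coquelicot.
Open Scope R_scope.

(** * Complex derivatives *)

(** Only the coefficient 2 of the logarithm has to be sharp. Since |z2 - z1| < delta gives log
    (1/delta) <= log (1/|z2 - z1|), an additive constant K is at most (K / log (1/delta)) log (1/|z2
    - z1|) and disappears into C. So the sharp density need only have the right asymptotics at the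
    puncture 0, and no exact hyperbolic metric of the plane minus two points is required. The
    density sigma makes no sense on the whole range of g, which may leave the disk |w| < e^64; this
    is why the maximum is restricted to |g| <= 1. Comparing densities at a maximum requires
    second-order expansions of both g and log |g'|, hence three complex derivatives, while the
    hypotheses give one. The first half of the file therefore proves that a derivative is again
    differentiable, starting from Goursat's theorem. Densities are handled through their logarithms
    and normalised to curvature at most -4, like the density r / (r^2 - |z|^2) of the disk of radius
    r. *)

Definition Cder (f : C -> C) (z l : C) : Prop :=
  forall eps : R, 0 < eps -> exists d : R, 0 < d /\
    forall h : C, Cmod h < d ->
      Cmod (f (z + h) - f z - l * h)%C <= eps * Cmod h.

Lemma Cplus_sub (a b : C) : (a + (b - a) = b)%C.
Proof. ring. Qed.

Lemma Cder_is_derive (f : C -> C) (z l : C) :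
  @is_derive C_AbsRing C_NormedModule f z l <-> Cder f z l.
Proof.
split.
- intros [_ H] eps Heps.
  destruct (H z (fun P HP => HP) (mkposreal eps Heps)) as [d Hd].
  exists d; split; [apply cond_pos|].
  intros h Hh.
  assert (E : (z + h - z = h)%C) by ring.
  assert (Hb : @ball (AbsRing_UniformSpace C_AbsRing) z d (z + h)%C).
  { change (Cmod (z + h - z)%C < d). now rewrite E. }
  specialize (Hd (z + h)%C Hb).
  change (Cmod (f (z + h) - f z - (z + h - z) * l)%C <= eps * Cmod (z + h - z)%C) in Hd.
  rewrite E in Hd. now rewrite (Cmult_comm l h).
- intros H; split.
  + apply (is_linear_scal_l (K := C_AbsRing) (V := C_NormedModule)).
  + intros x Hx.
    (* [is_derive] asks for the expansion at every limit point [x] of the filter; [z] is the only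
       one. *)
    rewrite <- (is_filter_lim_locally_unique (K := C_AbsRing) (V := AbsRing_NormedModule C_AbsRing) z x Hx).
    clear x Hx.
    intros eps; destruct (H eps (cond_pos eps)) as [d [Hd1 Hd]].
    exists (mkposreal d Hd1). intros y Hy.
    change (Cmod (y - z)%C < d) in Hy.
    specialize (Hd _ Hy).
    change (Cmod (f y - f z - (y - z) * l)%C <= eps * Cmod (y - z)%C).
    assert (E : forall a b : C, (a + (b - a) = b)%C) by (intros; ring). rewrite (E z y) in Hd.
    now rewrite (Cmult_comm (y - z) l).
Qed.

Lemma Cder_ext_loc (f g : C -> C) (z l : C) :
  (exists d, 0 < d /\ forall h, Cmod h < d -> f (z + h)%C = g (z + h)%C) ->
  Cder f z l -> Cder g z l.
Proof.
intros [d [Hd E]] H eps He.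
destruct (H eps He) as [d' [Hd' H']].
exists (Rmin d d'); split; [now apply Rmin_glb_lt|].
intros h Hh.
assert (E0 : f z = g z).
{ replace z with (z + 0)%C by ring. apply E. now rewrite Cmod_0. }
rewrite <- E0, <- E.
- apply H'. eapply Rlt_le_trans; [exact Hh|apply Rmin_r].
- eapply Rlt_le_trans; [exact Hh|apply Rmin_l].
Qed.

Lemma Cder_unique (f : C -> C) (z l l' : C) : Cder f z l -> Cder f z l' -> l = l'.
Proof.
intros H1 H2.
apply Cder_is_derive in H1, H2.
rewrite <- (is_C_derive_unique f z l H1). now apply is_C_derive_unique.
Qed.

Lemma Cder_const (a z : C) : Cder (fun _ => a) z 0.
Proof. apply Cder_is_derive. apply (@is_derive_const C_AbsRing C_NormedModule). Qed.

Lemma Cder_id (z : C) : Cder (fun w => w) z 1.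
Proof.
intros eps He. exists 1; split; [lra|]. intros h _.
replace (z + h - z - 1 * h)%C with (RtoC 0) by ring.
rewrite Cmod_0. apply Rmult_le_pos; [lra|apply Cmod_ge_0].
Qed.

Lemma Cder_plus (f g : C -> C) (z a b : C) :
  Cder f z a -> Cder g z b -> Cder (fun w => f w + g w)%C z (a + b)%C.
Proof.
rewrite <- !Cder_is_derive; intros. now apply (@is_derive_plus C_AbsRing C_NormedModule).
Qed.

Lemma Cder_minus (f g : C -> C) (z a b : C) :
  Cder f z a -> Cder g z b -> Cder (fun w => f w - g w)%C z (a - b)%C.
Proof.
rewrite <- !Cder_is_derive; intros. now apply (@is_derive_minus C_AbsRing C_NormedModule).
Qed.

Lemma Cder_cont (f : C -> C) (z l : C) : Cder f z l ->
  forall eps, 0 < eps -> exists d, 0 < d /\ forall h, Cmod h < d ->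
    Cmod (f (z + h) - f z)%C < eps.
Proof.
intros H eps He.
destruct (H 1 Rlt_0_1) as [d [Hd H']].
assert (Hl := Cmod_ge_0 l).
exists (Rmin d (eps / (Cmod l + 2))); split.
- apply Rmin_glb_lt; [trivial|]. apply Rdiv_lt_0_compat; lra.
- intros h Hh.
  assert (H1 : Cmod h < d) by (eapply Rlt_le_trans; [exact Hh|apply Rmin_l]).
  assert (H2 : Cmod h < eps / (Cmod l + 2)) by (eapply Rlt_le_trans; [exact Hh|apply Rmin_r]).
  specialize (H' _ H1).
  replace (f (z + h) - f z)%C with ((f (z + h) - f z - l * h) + l * h)%C by ring.
  eapply Rle_lt_trans; [apply Cmod_triangle|]. rewrite Cmod_mult.
  assert (H3 : Cmod h * (Cmod l + 2) < eps).
  { apply (Rmult_lt_compat_r (Cmod l + 2)) in H2; [|lra].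
    replace (eps / (Cmod l + 2) * (Cmod l + 2)) with eps in H2 by (field; lra). exact H2. }
  assert (H4 := Cmod_ge_0 h). nra.
Qed.

Lemma Cmod_triangle_rev (a b : C) : Cmod a - Cmod b <= Cmod (a - b).
Proof.
assert (H := Cmod_triangle (a - b) b).
replace (a - b + b)%C with a in H by ring. lra.
Qed.

Lemma Cder_inv (z : C) : z <> 0 -> Cder Cinv z (- / (z * z))%C.
Proof.
intros Hz eps He.
assert (Hm : 0 < Cmod z) by now apply Cmod_gt_0.
set (m := Cmod z) in *.
assert (Hm3 : 0 < eps * m ^ 3 / 2) by (assert (0 < m ^ 3) by (now apply pow_lt); nra).
(* For |h| < m/2 one has |z + h| > m/2, so the remainder h^2 / (z^2 (z + h)) is at most 2 |h|^2 /
   m^3; the second radius makes this at most eps |h|. *)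
exists (Rmin (m / 2) (eps * m ^ 3 / 2)); split; [apply Rmin_glb_lt; lra|].
intros h Hh.
assert (H1 : Cmod h < m / 2) by (eapply Rlt_le_trans; [exact Hh|apply Rmin_l]).
assert (H2 : Cmod h < eps * m ^ 3 / 2) by (eapply Rlt_le_trans; [exact Hh|apply Rmin_r]).
assert (H3 : m / 2 < Cmod (z + h)).
{ assert (T := Cmod_triangle_rev z (- h)). rewrite Cmod_opp in T.
  replace (z - - h)%C with (z + h)%C in T by ring. fold m in T. lra. }
assert (Hzh : (z + h)%C <> 0) by (apply Cmod_gt_0; lra).
replace (/ (z + h) - / z - - / (z * z) * h)%C with (h * (h / (z * z * (z + h))))%C
  by (field; auto).
rewrite Cmod_mult, Rmult_comm.
apply Rmult_le_compat_r; [apply Cmod_ge_0|].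
rewrite Cmod_div by (repeat apply Cmult_neq_0; trivial).
rewrite !Cmod_mult. fold m.
apply Rle_div_l.
- apply Rmult_lt_0_compat; [|lra]. now apply Rmult_lt_0_compat.
- assert (0 < m * m) by nra.
  assert (m * m * (m/2) <= m * m * Cmod (z + h)) by nra.
  assert (eps * (m * m * (m/2)) <= eps * (m * m * Cmod (z + h))) by nra.
  nra.
Qed.

Lemma Cder_eq (f : C -> C) (z a b : C) : a = b -> Cder f z a -> Cder f z b.
Proof. now intros ->. Qed.

Lemma Cder_mult (f g : C -> C) (z a b : C) :
  Cder f z a -> Cder g z b -> Cder (fun w => f w * g w)%C z (a * g z + f z * b)%C.
Proof.
intros Hf Hg eps He.
assert (Ha := Cmod_ge_0 a). assert (Hf0 := Cmod_ge_0 (f z)). assert (Hg0 := Cmod_ge_0 (g z)).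
set (e := eps / (Cmod a + Cmod (f z) + Cmod (g z) + 1)).
assert (He' : 0 < e) by (apply Rdiv_lt_0_compat; lra).
destruct (Hf e He') as [d1 [Hd1 H1]].
destruct (Hg e He') as [d2 [Hd2 H2]].
destruct (Cder_cont g z b Hg (Rmin 1 e) (Rmin_glb_lt _ _ _ Rlt_0_1 He')) as [d3 [Hd3 H3]].
exists (Rmin d1 (Rmin d2 d3)); split; [repeat apply Rmin_glb_lt; trivial|].
intros h Hh.
apply Rmin_Rgt_l in Hh as [Hh1 Hh]. apply Rmin_Rgt_l in Hh as [Hh2 Hh3].
specialize (H1 h Hh1). specialize (H2 h Hh2). specialize (H3 h Hh3).
apply Rmin_Rgt_l in H3 as [H3 H4].
replace (f (z + h) * g (z + h) - f z * g z - (a * g z + f z * b) * h)%C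
  with ((f (z + h) - f z - a * h) * g (z + h) + (a * h * (g (z + h) - g z)
     + f z * (g (z + h) - g z - b * h)))%C by ring.
eapply Rle_trans; [apply Cmod_triangle|].
eapply Rle_trans; [apply Rplus_le_compat_l, Cmod_triangle|].
rewrite !Cmod_mult.
assert (H5 : Cmod (g (z + h)%C) <= Cmod (g z) + 1).
{ assert (T := Cmod_triangle_rev (g (z + h)%C) (g z)). lra. }
assert (Hh0 := Cmod_ge_0 h).
assert (Hx := Cmod_ge_0 (f (z + h) - f z - a * h)%C).
assert (Hg1 := Cmod_ge_0 (g (z + h)%C)).
apply Rle_trans with (e * Cmod h * (Cmod (g z) + 1) + (Cmod a * Cmod h * e + Cmod (f z) * (e * Cmod h))).
- apply Rplus_le_compat; [|apply Rplus_le_compat].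
  + apply Rmult_le_compat; trivial.
  + apply Rmult_le_compat_l; [nra|lra].
  + apply Rmult_le_compat_l; trivial.
- apply Req_le. unfold e. field. lra.
Qed.

Lemma Cder_comp (f g : C -> C) (z a b : C) :
  Cder f (g z) a -> Cder g z b -> Cder (fun w => f (g w)) z (a * b)%C.
Proof.
intros Hf Hg eps He.
assert (Ha := Cmod_ge_0 a). assert (Hb := Cmod_ge_0 b).
set (e := Rmin 1 (eps / (Cmod a + Cmod b + 1))).
assert (He' : 0 < e) by (apply Rmin_glb_lt; [lra|apply Rdiv_lt_0_compat; lra]).
assert (He1 : e <= 1) by apply Rmin_l.
assert (He2 : e * (Cmod a + Cmod b + 1) <= eps).
{ apply Rle_div_r; [lra|apply Rmin_r]. }
destruct (Hf e He') as [d1 [Hd1 H1]].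
destruct (Hg e He') as [d2 [Hd2 H2]].
destruct (Cder_cont g z b Hg d1 Hd1) as [d3 [Hd3 H3]].
exists (Rmin d2 d3); split; [repeat apply Rmin_glb_lt; trivial|].
intros h Hh.
apply Rmin_Rgt_l in Hh as [Hh2 Hh3].
specialize (H2 h Hh2). specialize (H3 h Hh3). specialize (H1 _ H3).
replace (g z + (g (z + h) - g z))%C with (g (z + h)%C) in H1 by ring.
replace (f (g (z + h)) - f (g z) - a * b * h)%C
  with ((f (g (z + h)) - f (g z) - a * (g (z + h) - g z)) + a * (g (z + h) - g z - b * h))%C by ring.
eapply Rle_trans; [apply Cmod_triangle|].
rewrite Cmod_mult.
assert (Hh0 := Cmod_ge_0 h).
assert (H5 : Cmod (g (z + h) - g z)%C <= (Cmod b + 1) * Cmod h).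
{ replace (g (z + h) - g z)%C with ((g (z + h) - g z - b * h) + b * h)%C by ring.
  eapply Rle_trans; [apply Cmod_triangle|]. rewrite Cmod_mult. nra. }
apply Rle_trans with (e * ((Cmod b + 1) * Cmod h) + Cmod a * (e * Cmod h)).
- apply Rplus_le_compat; [eapply Rle_trans; [apply H1|]; apply Rmult_le_compat_l; lra|].
  apply Rmult_le_compat_l; trivial.
- replace (e * ((Cmod b + 1) * Cmod h) + Cmod a * (e * Cmod h))
    with (e * (Cmod a + Cmod b + 1) * Cmod h) by ring.
  apply Rmult_le_compat_r; lra.
Qed.

Lemma Cder_div (f g : C -> C) (z a b : C) :
  g z <> 0 -> Cder f z a -> Cder g z b ->
  Cder (fun w => f w / g w)%C z ((a * g z - f z * b) / (g z * g z))%C.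
Proof.
intros Hz Hf Hg.
apply Cder_eq with (a * / g z + f z * (- / (g z * g z) * b))%C; [field; trivial|].
apply (Cder_mult f (fun w => / g w)%C); trivial.
apply (Cder_comp Cinv g); trivial. now apply Cder_inv.
Qed.

(** * Integrals along paths *)

Lemma im_le_Cmod (c : C) : Rabs (Im c) <= Cmod c.
Proof. eapply Rle_trans; [|apply Rmax_Cmod]. apply Rmax_r. Qed.

Lemma Cmod_le_abs_sum (c : C) : Cmod c <= Rabs (Re c) + Rabs (Im c).
Proof.
destruct c as [x y]; simpl.
replace (x, y) with (RtoC x + Ci * RtoC y)%C.
- eapply Rle_trans; [apply Cmod_triangle|]. rewrite Cmod_mult, Cmod_Ci, !Cmod_R. lra.
- unfold RtoC, Ci, Cplus, Cmult; simpl. f_equal; ring.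
Qed.

Definition path_cont (f : R -> C) (t : R) : Prop :=
  forall eps, 0 < eps -> exists d, 0 < d /\
    forall s, Rabs (s - t) < d -> Cmod (f s - f t)%C < eps.

Lemma path_cont_re (f : R -> C) (t : R) :
  path_cont f t -> continuous (fun s => Re (f s)) t.
Proof.
intros H. apply continuity_pt_filterlim, continuity_pt_locally.
intros eps. destruct (H eps (cond_pos eps)) as [d [Hd H']].
exists (mkposreal d Hd). intros s Hs.
eapply Rle_lt_trans; [|apply (H' s Hs)].
apply (re_le_Cmod (f s - f t)).
Qed.

Lemma path_cont_im (f : R -> C) (t : R) :
  path_cont f t -> continuous (fun s => Im (f s)) t.
Proof.
intros H. apply continuity_pt_filterlim, continuity_pt_locally.
intros eps. destruct (H eps (cond_pos eps)) as [d [Hd H']].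
exists (mkposreal d Hd). intros s Hs.
eapply Rle_lt_trans; [|apply (H' s Hs)].
apply (im_le_Cmod (f s - f t)).
Qed.

Lemma path_cont_of_re_im (f : R -> C) (t : R) :
  continuous (fun s => Re (f s)) t -> continuous (fun s => Im (f s)) t -> path_cont f t.
Proof.
intros H1 H2 eps He.
apply continuity_pt_filterlim in H1, H2.
rewrite continuity_pt_locally in H1, H2.
assert (He2 : 0 < eps / 2) by lra.
destruct (H1 (mkposreal _ He2)) as [d1 H1'].
destruct (H2 (mkposreal _ He2)) as [d2 H2'].
exists (Rmin d1 d2); split; [apply Rmin_glb_lt; apply cond_pos|].
intros s Hs. apply Rmin_Rgt_l in Hs as [Hs1 Hs2].
specialize (H1' s Hs1). specialize (H2' s Hs2). simpl in H1', H2'.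
eapply Rle_lt_trans; [apply Cmod_le_abs_sum|].
change (Re (f s - f t)%C) with (Re (f s) - Re (f t)).
change (Im (f s - f t)%C) with (Im (f s) - Im (f t)). lra.
Qed.

Lemma path_cont_mult (f g : R -> C) (t : R) :
  path_cont f t -> path_cont g t -> path_cont (fun s => f s * g s)%C t.
Proof.
intros Hf Hg.
assert (A1 := path_cont_re f t Hf). assert (A2 := path_cont_im f t Hf).
assert (B1 := path_cont_re g t Hg). assert (B2 := path_cont_im g t Hg).
apply path_cont_of_re_im; simpl.
- apply (continuous_minus (fun s => Re (f s) * Re (g s)) (fun s => Im (f s) * Im (g s)));
  now apply (continuous_mult (K := R_AbsRing)).
- apply (continuous_plus (fun s => Re (f s) * Im (g s)) (fun s => Im (f s) * Re (g s)));
  now apply (continuous_mult (K := R_AbsRing)).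
Qed.

Lemma path_cont_minus (f g : R -> C) (t : R) :
  path_cont f t -> path_cont g t -> path_cont (fun s => f s - g s)%C t.
Proof.
intros Hf Hg.
apply path_cont_of_re_im.
- apply (continuous_minus (fun s => Re (f s)) (fun s => Re (g s))); now apply path_cont_re.
- apply (continuous_minus (fun s => Im (f s)) (fun s => Im (g s))); now apply path_cont_im.
Qed.

Lemma path_cont_const (c : C) (t : R) : path_cont (fun _ => c) t.
Proof. apply path_cont_of_re_im; apply continuous_const. Qed.

Lemma path_cont_comp (f : C -> C) (g : R -> C) (t : R) (l : C) :
  Cder f (g t) l -> path_cont g t -> path_cont (fun s => f (g s)) t.
Proof.
intros Hf Hg eps He.
destruct (Cder_cont _ _ _ Hf eps He) as [d [Hd H]].
destruct (Hg d Hd) as [d' [Hd' H']].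
exists d'; split; trivial. intros s Hs.
specialize (H _ (H' s Hs)).
now replace (g t + (g s - g t))%C with (g s) in H by ring.
Qed.

Definition CInt (f : R -> C) (a b : R) : C :=
  (RInt (fun t => Re (f t)) a b, RInt (fun t => Im (f t)) a b).

Definition path_cont_on (f : R -> C) (a b : R) : Prop :=
  forall t, a <= t <= b -> path_cont f t.

Lemma ex_RInt_re (f : R -> C) (a b : R) :
  a <= b -> path_cont_on f a b -> ex_RInt (fun t => Re (f t)) a b.
Proof.
intros Hab H. apply (@ex_RInt_continuous R_CompleteNormedModule).
intros t Ht. rewrite Rmin_left, Rmax_right in Ht by trivial. now apply path_cont_re, H.
Qed.

Lemma ex_RInt_im (f : R -> C) (a b : R) :
  a <= b -> path_cont_on f a b -> ex_RInt (fun t => Im (f t)) a b.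
Proof.
intros Hab H. apply (@ex_RInt_continuous R_CompleteNormedModule).
intros t Ht. rewrite Rmin_left, Rmax_right in Ht by trivial. now apply path_cont_im, H.
Qed.

Lemma CInt_Chasles (f : R -> C) (a b c : R) :
  a <= b -> b <= c -> path_cont_on f a c ->
  CInt f a c = (CInt f a b + CInt f b c)%C.
Proof.
intros Hab Hbc H.
assert (H1 : path_cont_on f a b) by (intros t Ht; apply H; lra).
assert (H2 : path_cont_on f b c) by (intros t Ht; apply H; lra).
unfold CInt, Cplus; f_equal; symmetry.
- apply (RInt_Chasles (V := R_CompleteNormedModule) (fun t => Re (f t))); now apply ex_RInt_re.
- apply (RInt_Chasles (V := R_CompleteNormedModule) (fun t => Im (f t))); now apply ex_RInt_im.
Qed.

Lemma CInt_ext (f g : R -> C) (a b : R) :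
  a <= b -> (forall t, a < t < b -> f t = g t) -> CInt f a b = CInt g a b.
Proof.
intros Hab H. unfold CInt; f_equal; apply RInt_ext; rewrite Rmin_left, Rmax_right by trivial;
 intros t Ht; now rewrite H.
Qed.

Lemma CInt_minus (f g : R -> C) (a b : R) :
  a <= b -> path_cont_on f a b -> path_cont_on g a b ->
  CInt (fun t => f t - g t)%C a b = (CInt f a b - CInt g a b)%C.
Proof.
intros Hab Hf Hg.
unfold CInt, Cminus, Cplus, Copp; simpl; f_equal.
- apply (RInt_minus (V := R_CompleteNormedModule) (fun t => Re (f t)) (fun t => Re (g t)));
  now apply ex_RInt_re.
- apply (RInt_minus (V := R_CompleteNormedModule) (fun t => Im (f t)) (fun t => Im (g t)));
  now apply ex_RInt_im.
Qed.

Lemma CInt_scal (f : R -> C) (c : C) (a b : R) :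
  a <= b -> path_cont_on f a b ->
  CInt (fun t => c * f t)%C a b = (c * CInt f a b)%C.
Proof.
intros Hab Hf.
assert (H1 := ex_RInt_re f a b Hab Hf).
assert (H2 := ex_RInt_im f a b Hab Hf).
unfold CInt, Cmult; simpl; f_equal.
- apply (is_RInt_unique (V := R_CompleteNormedModule)).
  exact (is_RInt_minus (V := R_NormedModule) _ _ a b _ _
    (is_RInt_scal (V := R_NormedModule) _ a b (Re c) _ (RInt_correct _ _ _ H1))
    (is_RInt_scal (V := R_NormedModule) _ a b (Im c) _ (RInt_correct _ _ _ H2))).
- apply (is_RInt_unique (V := R_CompleteNormedModule)).
  exact (is_RInt_plus (V := R_NormedModule) _ _ a b _ _
    (is_RInt_scal (V := R_NormedModule) _ a b (Re c) _ (RInt_correct _ _ _ H2))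
    (is_RInt_scal (V := R_NormedModule) _ a b (Im c) _ (RInt_correct _ _ _ H1))).
Qed.

Lemma CInt_const (c : C) (a b : R) : CInt (fun _ => c) a b = (c * RtoC (b - a))%C.
Proof.
unfold CInt. rewrite !RInt_const.
unfold Cmult, RtoC, Re, Im, scal; simpl; unfold mult; simpl. f_equal; ring.
Qed.

(** Real and imaginary parts are bounded separately, which costs the factor 2. It is harmless: the
    bound only serves limits and local finiteness, never a constant of the theorem. *)
Lemma CInt_bound (f : R -> C) (a b M : R) :
  a <= b -> path_cont_on f a b ->
  (forall t, a <= t <= b -> Cmod (f t) <= M) ->
  Cmod (CInt f a b) <= 2 * (M * (b - a)).
Proof.
intros Hab Hf HM.
eapply Rle_trans; [apply Cmod_le_abs_sum|]. simpl.
replace (2 * (M * (b - a))) with ((b - a) * M + (b - a) * M) by ring.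
apply Rplus_le_compat; apply abs_RInt_le_const; trivial.
- now apply ex_RInt_re.
- intros t Ht. eapply Rle_trans; [apply re_le_Cmod|now apply HM].
- now apply ex_RInt_im.
- intros t Ht. eapply Rle_trans; [apply im_le_Cmod|now apply HM].
Qed.

Lemma CInt_approx (f : R -> C) (k : C) (a b M : R) :
  a <= b -> path_cont_on f a b ->
  (forall t, a <= t <= b -> Cmod (f t - k)%C <= M) ->
  Cmod (CInt f a b - k * RtoC (b - a))%C <= 2 * (M * (b - a)).
Proof.
intros Hab Hf HM.
rewrite <- CInt_const, <- CInt_minus; trivial.
- apply CInt_bound; trivial. intros t Ht. apply path_cont_minus; [now apply Hf|apply path_cont_const].
- intros t Ht; apply path_cont_const.
Qed.

(** * Goursat's theorem on squares *)

Lemma Cder_segment_re (f : C -> C) (z k l : C) (t : R) :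
  Cder f (z + RtoC t * k)%C l ->
  derivable_pt_lim (fun s => Re (f (z + RtoC s * k)%C)) t (Re (l * k)%C).
Proof.
intros H eps He.
assert (Hk := Cmod_ge_0 k).
assert (He' : 0 < eps / (2 * (Cmod k + 1))) by (apply Rdiv_lt_0_compat; lra).
destruct (H _ He') as [d [Hd H']].
assert (Hd' : 0 < d / (Cmod k + 1)) by (apply Rdiv_lt_0_compat; lra).
exists (mkposreal _ Hd'). intros h Hh Hhd. simpl in Hhd.
assert (Hha : 0 < Rabs h) by now apply Rabs_pos_lt.
assert (Hm : Cmod (RtoC h * k) = Rabs h * Cmod k) by now rewrite Cmod_mult, Cmod_R.
assert (Hd1 : Cmod (RtoC h * k) < d).
{ rewrite Hm. apply Rlt_div_r in Hhd; [|lra]. nra. }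
specialize (H' _ Hd1). rewrite Hm in H'.
replace (z + RtoC t * k + RtoC h * k)%C with (z + RtoC (t + h) * k)%C in H'
  by (rewrite RtoC_plus; ring).
assert (Hr := re_le_Cmod (f (z + RtoC (t + h) * k) - f (z + RtoC t * k) - l * (RtoC h * k))%C).
replace (Re (f (z + RtoC (t + h) * k) - f (z + RtoC t * k) - l * (RtoC h * k))%C)
  with (h * ((Re (f (z + RtoC (t + h) * k)%C) - Re (f (z + RtoC t * k)%C)) / h - Re (l * k)%C)) in Hr.
2: { unfold Re, RtoC, Cminus, Cplus, Copp, Cmult; simpl. field. trivial. }
rewrite Rabs_mult in Hr.
apply Rmult_lt_reg_l with (Rabs h); trivial.
eapply Rle_lt_trans; [exact Hr|]. eapply Rle_lt_trans; [exact H'|].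
apply Rle_lt_trans with (Rabs h * (eps * (Cmod k / (2 * (Cmod k + 1))))).
- apply Req_le; field; lra.
- apply Rmult_lt_compat_l; trivial.
  rewrite <- (Rmult_1_r eps) at 2. apply Rmult_lt_compat_l; trivial.
  apply Rlt_div_l; lra.
Qed.

Lemma Cder_mulCi (f : C -> C) (z l : C) : Cder f z l -> Cder (fun w => Ci * f w)%C z (Ci * l)%C.
Proof.
intros H. apply Cder_eq with (0 * f z + Ci * l)%C; [ring|].
apply (Cder_mult (fun _ => Ci) f); trivial. apply Cder_const.
Qed.

(** The mean value theorem fails for complex values, so it is applied along the segment to Re f and
    to Re (i f) = - Im f; adding the two bounds gives the factor 2. *)
Lemma Cder_lipschitz (f df : C -> C) (z w : C) (K : R) :
  (forall t, 0 <= t <= 1 -> Cder f (z + RtoC t * (w - z))%C (df (z + RtoC t * (w - z))%C)) ->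
  (forall t, 0 <= t <= 1 -> Cmod (df (z + RtoC t * (w - z))%C) <= K) ->
  Cmod (f w - f z)%C <= 2 * K * Cmod (w - z)%C.
Proof.
assert (W : forall f df, (forall t, 0 <= t <= 1 -> Cder f (z + RtoC t * (w - z))%C (df (z + RtoC t * (w - z))%C)) ->
  (forall t, 0 <= t <= 1 -> Cmod (df (z + RtoC t * (w - z))%C) <= K) ->
  Rabs (Re (f w - f z)%C) <= K * Cmod (w - z)%C).
{ clear f df; intros f df Hf HK.
  destruct (MVT_cor2 (fun s => Re (f (z + RtoC s * (w - z))%C))
    (fun s => Re (df (z + RtoC s * (w - z)) * (w - z))%C) 0 1 Rlt_0_1) as [c [Hc Hc']].
  - intros c Hc. apply Cder_segment_re. now apply Hf.
  - replace (z + RtoC 1 * (w - z))%C with w in Hc by ring.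
    replace (z + RtoC 0 * (w - z))%C with z in Hc by ring.
    change (Re (f w - f z)%C) with (Re (f w) - Re (f z)). rewrite Hc.
    rewrite Rminus_0_r, Rmult_1_r.
    eapply Rle_trans; [apply re_le_Cmod|]. rewrite Cmod_mult.
    apply Rmult_le_compat_r; [apply Cmod_ge_0|]. apply HK; lra. }
intros Hf HK.
assert (H1 := W f df Hf HK).
assert (H2 : Rabs (Re (Ci * f w - Ci * f z)%C) <= K * Cmod (w - z)%C).
{ apply (W (fun u => Ci * f u)%C (fun u => Ci * df u)%C).
  - intros t Ht. now apply Cder_mulCi, Hf.
  - intros t Ht. rewrite Cmod_mult, Cmod_Ci, Rmult_1_l. now apply HK. }
replace (Re (Ci * f w - Ci * f z)%C) with (- Im (f w - f z)%C) in H2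
  by (unfold Re, Im, Ci, Cminus, Cplus, Copp, Cmult; simpl; ring).
rewrite Rabs_Ropp in H2.
eapply Rle_trans; [apply Cmod_le_abs_sum|]. lra.
Qed.

(** The intervals from x n to x n + s / 2^n are nested, and the supremum of their left ends lies in
    all of them. It locates one coordinate of the limit point of shrinking squares. *)
Lemma nested_limit (x : nat -> R) (s : R) :
  (forall n, x n <= x (S n) <= x n + s / 2 ^ (S n)) ->
  exists l, forall n, x n <= l <= x n + s / 2 ^ n.
Proof.
intros H.
assert (Hs : forall n, s / 2 ^ n = s / 2 ^ S n + s / 2 ^ S n).
{ intros n. simpl. field. apply pow_nonzero; lra. }
assert (H1 : forall n k, x n <= x (n + k)%nat).
{ intros n k; induction k; [rewrite Nat.add_0_r; lra|].
  rewrite Nat.add_succ_r. destruct (H (n + k)%nat); lra. }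
assert (H2 : forall n k, x (n + k)%nat + s / 2 ^ (n + k) <= x n + s / 2 ^ n).
{ intros n k; induction k; [rewrite Nat.add_0_r; lra|].
  rewrite Nat.add_succ_r. destruct (H (n + k)%nat). rewrite (Hs (n + k)%nat) in IHk. lra. }
assert (Hp : forall n, 0 <= s / 2 ^ S n) by (intros n; destruct (H n); lra).
assert (Hp' : forall n, 0 <= s / 2 ^ n) by (intros n; rewrite Hs; specialize (Hp n); lra).
assert (H3 : forall n m, x m <= x n + s / 2 ^ n).
{ intros n m. destruct (Nat.le_ge_cases n m) as [L|L].
  - replace m with (n + (m - n))%nat by lia. specialize (H2 n (m - n)%nat).
    specialize (Hp' (n + (m - n))%nat). lra.
  - specialize (H1 m (n - m)%nat). replace (m + (n - m))%nat with n in H1 by lia.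
    specialize (Hp' n). lra. }
destruct (completeness (fun y => exists n, y = x n)) as [l [Hl1 Hl2]].
- exists (x 0%nat + s / 2 ^ 0). intros y [n ->]. apply H3.
- exists (x 0%nat). now exists 0%nat.
- exists l. intros n; split.
  + apply Hl1. now exists n.
  + apply Hl2. intros y [m ->]. apply H3.
Qed.

(** The contour integral of g, counterclockwise around the square with lower left corner (x, y) and
    side s. Opposite sides share one integrand, so that differences of g can be estimated
    pointwise. *)
Definition square_int (g : C -> C) (x y s : R) : C :=
  (CInt (fun t => g (t, y) - g (t, (y + s)%R))%C x (x + s)
   + Ci * CInt (fun t => g ((x + s)%R, t) - g (x, t))%C y (y + s))%C.

(** A left half-plane, because exp maps it onto the punctured disk of radius e^B, where difference
    quotients will live. *)
Definition diff_halfplane (g : C -> C) (B : R) : Prop :=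
  forall x y, x <= B -> exists l, Cder g (x, y) l.

Lemma path_cont_horizontal (g : C -> C) (B x y : R) :
  diff_halfplane g B -> x <= B -> path_cont (fun t => g (t, y)) x.
Proof.
intros Hg Hx. destruct (Hg x y Hx) as [l Hl].
apply (path_cont_comp g (fun t => (t, y)) x l Hl).
apply path_cont_of_re_im; [apply continuous_id|apply continuous_const].
Qed.

Lemma path_cont_vertical (g : C -> C) (B x y : R) :
  diff_halfplane g B -> x <= B -> path_cont (fun t => g (x, t)) y.
Proof.
intros Hg Hx. destruct (Hg x y Hx) as [l Hl].
apply (path_cont_comp g (fun t => (x, t)) y l Hl).
apply path_cont_of_re_im; [apply continuous_const|apply continuous_id].
Qed.

Lemma square_int_split (g : C -> C) (B x y s : R) :
  diff_halfplane g B -> 0 <= s -> x + s <= B ->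
  square_int g x y s =
   (CInt (fun t => g (t, y)) x (x + s) - CInt (fun t => g (t, (y + s)%R)) x (x + s)
    + Ci * (CInt (fun t => g ((x + s)%R, t)) y (y + s) - CInt (fun t => g (x, t)) y (y + s)))%C.
Proof.
intros Hg Hs HB. unfold square_int.
rewrite !CInt_minus; trivial; try lra; intros t Ht;
 (apply (path_cont_horizontal g B) || apply (path_cont_vertical g B)); trivial; lra.
Qed.

(** Each inner edge is traversed twice, in opposite directions. *)
Lemma square_int_bisect (g : C -> C) (B x y h : R) :
  diff_halfplane g B -> 0 <= h -> x + (h + h) <= B ->
  square_int g x y (h + h) =
   (square_int g x y h + square_int g (x + h) y h
    + square_int g x (y + h) h + square_int g (x + h) (y + h) h)%C.
Proof.
intros Hg Hh HB.
rewrite !(square_int_split g B) by (trivial; lra).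
rewrite <- !Rplus_assoc.
rewrite !(CInt_Chasles _ x (x + h) (x + h + h)), !(CInt_Chasles _ y (y + h) (y + h + h)); try lra.
1: ring.
all: intros t Ht; (apply (path_cont_horizontal g B) || apply (path_cont_vertical g B)); trivial; lra.
Qed.

(** The ratio of the modulus of the integral to the area survives on some quarter: four quarters all
    below c (s/2)^2 would add up to less than c s^2. *)
Lemma square_bisect_step (g : C -> C) (B c x y s : R) :
  diff_halfplane g B -> 0 <= s -> x + s <= B ->
  c * s ^ 2 <= Cmod (square_int g x y s) ->
  exists p : R * R, x <= fst p <= x + s / 2 /\ y <= snd p <= y + s / 2 /\
    c * (s / 2) ^ 2 <= Cmod (square_int g (fst p) (snd p) (s / 2)).
Proof.
intros Hg Hs HB Hc.
replace s with (s / 2 + s / 2) in Hc at 2 by field.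
rewrite (square_int_bisect g B) in Hc; trivial; try lra.
assert (T := Cmod_triangle (square_int g x y (s / 2) + square_int g (x + s / 2) y (s / 2)
    + square_int g x (y + s / 2) (s / 2)) (square_int g (x + s / 2) (y + s / 2) (s / 2))).
assert (T1 := Cmod_triangle (square_int g x y (s / 2) + square_int g (x + s / 2) y (s / 2))
    (square_int g x (y + s / 2) (s / 2))).
assert (T2 := Cmod_triangle (square_int g x y (s / 2)) (square_int g (x + s / 2) y (s / 2))).
destruct (Rle_dec (c * (s / 2) ^ 2) (Cmod (square_int g x y (s / 2)))).
{ exists (x, y); simpl; repeat split; trivial; lra. }
destruct (Rle_dec (c * (s / 2) ^ 2) (Cmod (square_int g (x + s / 2) y (s / 2)))).
{ exists (x + s / 2, y); simpl; repeat split; trivial; lra. }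
destruct (Rle_dec (c * (s / 2) ^ 2) (Cmod (square_int g x (y + s / 2) (s / 2)))).
{ exists (x, y + s / 2); simpl; repeat split; trivial; lra. }
destruct (Rle_dec (c * (s / 2) ^ 2) (Cmod (square_int g (x + s / 2) (y + s / 2) (s / 2)))).
{ exists (x + s / 2, y + s / 2); simpl; repeat split; trivial; lra. }
exfalso. nra.
Qed.

(** The affine part of g at p contributes - l i s^2 from the horizontal sides and + l i s^2 from the
    vertical ones, so only the remainder counts. The remainder is at most 4 eps s on each pair of
    sides, and [CInt_approx] doubles it. *)
Lemma square_int_small (g : C -> C) (B : R) (p l : C) :
  diff_halfplane g B -> Cder g p l ->
  forall eps, 0 < eps -> exists d, 0 < d /\ forall x y s, 0 <= s < d -> x + s <= B ->
    x <= fst p <= x + s -> y <= snd p <= y + s ->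
    Cmod (square_int g x y s) <= 16 * eps * s ^ 2.
Proof.
intros Hg Hl eps He. destruct (Hl eps He) as [d [Hd H]].
exists (d / 2); split; [lra|].
intros x y s Hs HB Hx Hy.
assert (E : forall u v, x <= u <= x + s -> y <= v <= y + s ->
  Cmod (g (u, v) - g p - l * ((u, v) - p))%C <= eps * (2 * s)).
{ intros u v Hu Hv.
  assert (Hm : Cmod ((u, v) - p)%C <= 2 * s).
  { eapply Rle_trans; [apply Cmod_le_abs_sum|].
    change (Re ((u, v) - p)%C) with (u - fst p). change (Im ((u, v) - p)%C) with (v - snd p).
    assert (Rabs (u - fst p) <= s) by (apply Rabs_le; lra).
    assert (Rabs (v - snd p) <= s) by (apply Rabs_le; lra). lra. }
  assert (Hlt : Cmod ((u, v) - p)%C < d) by lra.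
  specialize (H _ Hlt).
  rewrite Cplus_sub in H.
  eapply Rle_trans; [exact H|]. apply Rmult_le_compat_l; lra. }
assert (D : forall a b a' b' : R, x <= a <= x + s -> y <= b <= y + s ->
   x <= a' <= x + s -> y <= b' <= y + s ->
  Cmod (g (a, b) - g (a', b') - l * ((a, b) - (a', b')))%C <= 4 * eps * s).
{ intros a b a' b' Ha Hb Ha' Hb'.
  replace (g (a, b) - g (a', b') - l * ((a, b) - (a', b')))%C with
   ((g (a, b) - g p - l * ((a, b) - p)) + - (g (a', b') - g p - l * ((a', b') - p)))%C by ring.
  eapply Rle_trans; [apply Cmod_triangle|]. rewrite Cmod_opp.
  assert (E1 := E _ _ Ha Hb). assert (E2 := E _ _ Ha' Hb'). lra. }
assert (I1 : Cmod (CInt (fun t => g (t, y) - g (t, (y + s)%R))%C x (x + s) - - (l * Ci * RtoC s) * RtoC (x + s - x))%C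
   <= 2 * (4 * eps * s * (x + s - x))).
{ apply CInt_approx; [lra| |].
  - intros t Ht. apply path_cont_minus; apply (path_cont_horizontal g B); trivial; lra.
  - intros t Ht.
    replace (- (l * Ci * RtoC s))%C with (l * ((t, y) - (t, (y + s)%R)))%C.
    + apply D; lra.
    + unfold Ci, RtoC, Cminus, Cplus, Copp, Cmult; simpl; f_equal; ring. }
assert (I2 : Cmod (CInt (fun t => g ((x + s)%R, t) - g (x, t))%C y (y + s) - (l * RtoC s) * RtoC (y + s - y))%C
   <= 2 * (4 * eps * s * (y + s - y))).
{ apply CInt_approx; [lra| |].
  - intros t Ht. apply path_cont_minus; apply (path_cont_vertical g B); trivial; lra.
  - intros t Ht.
    replace (l * RtoC s)%C with (l * (((x + s)%R, t) - (x, t)))%C.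
    + apply D; lra.
    + unfold Ci, RtoC, Cminus, Cplus, Copp, Cmult; simpl; f_equal; ring. }
replace (x + s - x) with s in I1 by ring. replace (y + s - y) with s in I2 by ring.
unfold square_int.
set (A1 := CInt _ x (x + s)) in *. set (A2 := CInt _ y (y + s)) in *.
replace (A1 + Ci * A2)%C with ((A1 - - (l * Ci * RtoC s) * RtoC s)
  + Ci * (A2 - l * RtoC s * RtoC s))%C by ring.
eapply Rle_trans; [apply Cmod_triangle|]. rewrite (Cmod_mult Ci), Cmod_Ci. nra.
Qed.

(** Goursat's argument: a nonzero integral would keep its ratio c to the area along nested squares,
    whose limit point contradicts [square_int_small]. *)
Lemma square_int_zero (g : C -> C) (B x y s : R) :
  diff_halfplane g B -> 0 < s -> x + s <= B -> square_int g x y s = 0.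
Proof.
intros Hg Hs HB. apply Cmod_eq_0.
destruct (Rle_lt_or_eq_dec _ _ (Cmod_ge_0 (square_int g x y s))) as [Hp|Hp]; [exfalso|now symmetry].
set (c := Cmod (square_int g x y s) / s ^ 2).
assert (Hs2 : 0 < s ^ 2) by (apply pow_lt; lra).
assert (Hc : 0 < c) by (apply Rdiv_lt_0_compat; trivial).
set (Q := fun (n : nat) (p q : R * R) =>
  fst p <= fst q <= fst p + s / 2 ^ S n /\ snd p <= snd q <= snd p + s / 2 ^ S n /\
  c * (s / 2 ^ S n) ^ 2 <= Cmod (square_int g (fst q) (snd q) (s / 2 ^ S n))).
(* Lower left corners of the chosen quarters; [epsilon] makes the choice, and [HP] below shows that
   it always succeeds. *)
set (u := fix u (n : nat) : R * R := match n with O => (x, y)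
   | S n => epsilon (inhabits (x, y)) (Q n (u n)) end).
assert (Hpos : forall n, 0 < s / 2 ^ n) by (intros n; apply Rdiv_lt_0_compat; [|apply pow_lt]; lra).
assert (Hhalf : forall n, s / 2 ^ n / 2 = s / 2 ^ S n).
{ intros n; simpl; field; apply pow_nonzero; lra. }
assert (HP : forall n, fst (u n) + s / 2 ^ n <= B /\
   c * (s / 2 ^ n) ^ 2 <= Cmod (square_int g (fst (u n)) (snd (u n)) (s / 2 ^ n)) /\ Q n (u n) (u (S n))).
{ assert (HQ : forall n, fst (u n) + s / 2 ^ n <= B ->
     c * (s / 2 ^ n) ^ 2 <= Cmod (square_int g (fst (u n)) (snd (u n)) (s / 2 ^ n)) -> Q n (u n) (u (S n))).
  { intros n H1 H2. apply (epsilon_spec (inhabits (x, y)) (Q n (u n))).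
    destruct (square_bisect_step g B c (fst (u n)) (snd (u n)) (s / 2 ^ n) Hg) as [p Hp']; trivial.
    - left; apply Hpos.
    - exists p. rewrite Hhalf in Hp'. exact Hp'. }
  intros n; induction n as [|n [IH1 [IH2 IH3]]].
  - assert (H1 : fst (u 0%nat) + s / 2 ^ 0 <= B) by (simpl; lra).
    assert (H2 : c * (s / 2 ^ 0) ^ 2 <= Cmod (square_int g (fst (u 0%nat)) (snd (u 0%nat)) (s / 2 ^ 0))).
    { simpl fst; simpl snd. replace (s / 2 ^ 0) with s by (simpl; field).
      unfold c. apply Req_le; field; lra. }
    auto.
  - destruct IH3 as [H1 [H2 H3]].
    assert (H4 : fst (u (S n)) + s / 2 ^ S n <= B) by (specialize (Hhalf n); lra).
    auto. }
destruct (nested_limit (fun n => fst (u n)) s) as [l1 Hl1]; [intros n; apply (HP n)|].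
destruct (nested_limit (fun n => snd (u n)) s) as [l2 Hl2]; [intros n; apply (HP n)|].
assert (Hl : l1 <= B) by (specialize (Hl1 0%nat); destruct (HP 0%nat); lra).
destruct (Hg l1 l2 Hl) as [l Hd].
(* With eps = c/32 the upper bound 16 eps s^2 is half of the lower bound c s^2. *)
assert (Hc32 : 0 < c / 32) by lra.
destruct (square_int_small g B (l1, l2) l Hg Hd (c / 32) Hc32) as [d [Hd0 Hsm]].
assert (Hn : exists n, s / 2 ^ n < d).
{ assert (Hq : 0 < d / s) by (apply Rdiv_lt_0_compat; lra).
  destruct (pow_lt_1_zero (/ 2) ltac:(rewrite Rabs_pos_eq; lra) (d / s) Hq) as [N HN].
  exists N. specialize (HN N (Nat.le_refl N)). rewrite pow_inv in HN.
  rewrite Rabs_pos_eq in HN by (left; apply Rinv_0_lt_compat, pow_lt; lra).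
  apply Rlt_div_r in HN; trivial. unfold Rdiv; lra. }
destruct Hn as [n Hn].
destruct (HP n) as [H1 [H2 _]].
assert (H3 : Cmod (square_int g (fst (u n)) (snd (u n)) (s / 2 ^ n)) <= 16 * (c / 32) * (s / 2 ^ n) ^ 2).
{ apply Hsm; [specialize (Hpos n); lra|exact H1|apply Hl1|apply Hl2]. }
assert (H4 : 0 < (s / 2 ^ n) ^ 2) by apply pow_lt, Hpos. nra.
Qed.

(** * Differentiability of the derivative *)

Lemma derivable_pt_lim_approx (f : R -> R) (x l : R) :
  derivable_pt_lim f x l -> forall eps, 0 < eps -> exists d, 0 < d /\
    forall h, Rabs h < d -> Rabs (f (x + h) - f x - l * h) <= eps * Rabs h.
Proof.
intros H eps He. destruct (H eps He) as [d Hd].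
exists d; split; [apply cond_pos|]. intros h Hh.
destruct (Req_dec h 0) as [->|Hh0].
- rewrite Rplus_0_r, Rabs_R0. replace (f x - f x - l * 0) with 0 by ring. rewrite Rabs_R0; lra.
- specialize (Hd h Hh0 Hh).
  replace (f (x + h) - f x - l * h) with (((f (x + h) - f x) / h - l) * h) by (field; trivial).
  rewrite Rabs_mult. apply Rmult_le_compat_r; [apply Rabs_pos|lra].
Qed.

(** * The complex exponential, circles and the mean value formula for the derivative *)

Definition Cexp (z : C) : C := (exp (Re z) * cos (Im z), exp (Re z) * sin (Im z)).

Lemma Cexp_plus (z w : C) : Cexp (z + w) = (Cexp z * Cexp w)%C.
Proof.
destruct z as [a b], w as [c d]; unfold Cexp, Cmult, Cplus; simpl.
rewrite exp_plus, cos_plus, sin_plus. f_equal; ring.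
Qed.

Lemma Cmod_polar (r t : R) : 0 <= r -> Cmod (r * cos t, r * sin t) = r.
Proof.
intros Hr. unfold Cmod; cbn [fst snd].
replace ((r * cos t) ^ 2 + (r * sin t) ^ 2) with (r ^ 2 * (sin t ^ 2 + cos t ^ 2)) by ring.
rewrite <- !Rsqr_pow2, sin2_cos2, Rmult_1_r. now apply sqrt_Rsqr.
Qed.

Lemma Cmod_Cexp (z : C) : Cmod (Cexp z) = exp (Re z).
Proof. apply Cmod_polar. left; apply exp_pos. Qed.

Lemma Cexp_neq_0 (z : C) : Cexp z <> 0.
Proof. apply Cmod_gt_0. rewrite Cmod_Cexp. apply exp_pos. Qed.

Lemma Cexp_near_0 (eps : R) : 0 < eps -> exists d, 0 < d /\
  forall h, Cmod h < d -> Cmod (Cexp h - 1 - h)%C <= eps * Cmod h.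
Proof.
intros He.
set (e := Rmin 1 (eps / 9)).
assert (He0 : 0 < e) by (apply Rmin_glb_lt; lra).
assert (He1 : e <= 1) by apply Rmin_l.
assert (He2 : e <= eps / 9) by apply Rmin_r.
destruct (derivable_pt_lim_approx exp 0 1 derivable_pt_lim_exp_0 e He0) as [d1 [Hd1 H1]].
destruct (derivable_pt_lim_approx sin 0 1 derivable_pt_lim_sin_0 e He0) as [d2 [Hd2 H2]].
assert (Hc : derivable_pt_lim cos 0 0).
{ replace 0 with (- sin 0) at 2 by (rewrite sin_0; ring). apply derivable_pt_lim_cos. }
destruct (derivable_pt_lim_approx cos 0 0 Hc e He0) as [d3 [Hd3 H3]].
(* The radius e/2 ensures |exp x - 1| <= e; the errors below then total at most 6 e |h|, within the
   margin of eps/9. *)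
exists (Rmin (e / 2) (Rmin d1 (Rmin d2 d3))); split; [repeat apply Rmin_glb_lt; trivial; lra|].
intros [x y] Hh.
apply Rmin_Rgt_l in Hh as [G0 Hh]. apply Rmin_Rgt_l in Hh as [G1 Hh].
apply Rmin_Rgt_l in Hh as [G2 G3].
assert (Hx := re_le_Cmod (x, y)). assert (Hy := im_le_Cmod (x, y)). change (Rabs x <= Cmod (x, y)) in Hx. change (Rabs y <= Cmod (x, y)) in Hy.
set (m := Cmod (x, y)) in *.
specialize (H1 x ltac:(lra)). specialize (H2 y ltac:(lra)). specialize (H3 y ltac:(lra)).
rewrite !Rplus_0_l in *. rewrite exp_0 in H1. rewrite sin_0 in H2. rewrite cos_0 in H3.
rewrite Rmult_0_l, Rminus_0_r in H3. rewrite Rmult_1_l in *. rewrite Rminus_0_r in H2.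
assert (Px := Rabs_pos x). assert (Py := Rabs_pos y).
assert (Q1 : Rabs (exp x - 1) <= e).
{ replace (exp x - 1) with ((exp x - 1 - x) + x) by ring.
  eapply Rle_trans; [apply Rabs_triang|]. nra. }
assert (Q2 : 0 <= exp x <= 2).
{ split; [left; apply exp_pos|]. apply Rabs_le_between in Q1. lra. }
eapply Rle_trans; [apply Cmod_le_abs_sum|].
unfold Cexp, RtoC, Cminus, Cplus, Copp; simpl.
replace (exp x * cos y + - (1) + - x) with (exp x * (cos y - 1) + (exp x - 1 - x)) by ring.
replace (exp x * sin y + - 0 + - y) with (exp x * (sin y - y) + (exp x - 1) * y) by ring.
assert (T1 := Rabs_triang (exp x * (cos y - 1)) (exp x - 1 - x)).
assert (T2 := Rabs_triang (exp x * (sin y - y)) ((exp x - 1) * y)).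
rewrite (Rabs_mult (exp x)) in T1. rewrite (Rabs_mult (exp x)), (Rabs_mult (exp x - 1)) in T2. rewrite (Rabs_pos_eq (exp x)) in T1, T2 by lra.
assert (U1 : exp x * Rabs (cos y - 1) <= 2 * (e * Rabs y)).
{ apply Rmult_le_compat; trivial; try lra. apply Rabs_pos. }
assert (U2 : exp x * Rabs (sin y - y) <= 2 * (e * Rabs y)).
{ apply Rmult_le_compat; trivial; try lra. apply Rabs_pos. }
assert (U3 : Rabs (exp x - 1) * Rabs y <= e * Rabs y).
{ apply Rmult_le_compat_r; trivial. }
assert (U4 : e * Rabs x <= e * m) by (apply Rmult_le_compat_l; lra).
assert (U5 : e * Rabs y <= e * m) by (apply Rmult_le_compat_l; lra).
assert (0 <= m) by apply Cmod_ge_0.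
assert (U6 : e * m <= eps / 9 * m) by (apply Rmult_le_compat_r; lra).
assert (0 <= eps * m) by nra. lra.
Qed.

Lemma Cder_Cexp (z : C) : Cder Cexp z (Cexp z).
Proof.
intros eps He.
assert (Hp : 0 < Cmod (Cexp z)) by (rewrite Cmod_Cexp; apply exp_pos).
destruct (Cexp_near_0 (eps / Cmod (Cexp z))) as [d [Hd H]]; [now apply Rdiv_lt_0_compat|].
exists d; split; trivial. intros h Hh. specialize (H h Hh).
rewrite Cexp_plus.
replace (Cexp z * Cexp h - Cexp z - Cexp z * h)%C with (Cexp z * (Cexp h - 1 - h))%C by ring.
rewrite Cmod_mult. apply (Rmult_le_compat_l (Cmod (Cexp z))) in H; [|lra].
eapply Rle_trans; [exact H|]. apply Req_le; field; lra.
Qed.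

Definition circ (r t : R) : C := (r * cos t, r * sin t).

Lemma Cmod_circ (r t : R) : 0 <= r -> Cmod (circ r t) = r.
Proof. apply Cmod_polar. Qed.

Lemma circ_neq_0 (r t : R) : 0 < r -> circ r t <> 0.
Proof. intros Hr. apply Cmod_gt_0. rewrite Cmod_circ; lra. Qed.

Lemma Cexp_circ (r t : R) : 0 < r -> Cexp (ln r, t) = circ r t.
Proof. intros Hr. unfold Cexp, circ; simpl. now rewrite exp_ln. Qed.

Lemma path_cont_circ (r t : R) : path_cont (circ r) t.
Proof.
apply path_cont_of_re_im; simpl.
- apply (continuous_mult (K := R_AbsRing) (fun _ => r) cos); [apply continuous_const|].
  apply continuity_pt_filterlim, continuity_cos.
- apply (continuous_mult (K := R_AbsRing) (fun _ => r) sin); [apply continuous_const|].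
  apply continuity_pt_filterlim, continuity_sin.
Qed.

Lemma path_cont_div_circ (f : R -> C) (r t : R) : 0 < r ->
  path_cont f t -> path_cont (fun s => f s / circ r s)%C t.
Proof.
intros Hr Hf. apply (path_cont_mult f (fun s => / circ r s)%C); trivial.
apply (path_cont_comp Cinv (circ r) t (- / (circ r t * circ r t))%C).
- now apply Cder_inv, circ_neq_0.
- apply path_cont_circ.
Qed.

Lemma path_cont_shift (c : C) (r t : R) : path_cont (fun s => c + circ r s)%C t.
Proof.
intros eps He. destruct (path_cont_circ r t eps He) as [d [Hd H]].
exists d; split; trivial. intros s Hs.
replace (c + circ r s - (c + circ r t))%C with (circ r s - circ r t)%C by ring. auto.
Qed.

(* Substituting w = exp zeta turns the circles about 0 into vertical segments,
   and Goursat's theorem on squares of side 2 pi shows that the integral over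
   such a segment is unchanged by the translation x |-> x - 2 pi. *)
Lemma derivative_circle_mean (f : C -> C) (z l : C) (r r' : R) :
  0 < r < r' -> (forall w, Cmod (w - z)%C < r' -> exists l, Cder f w l) -> Cder f z l ->
  CInt (fun t => (f (z + circ r t) - f z) / circ r t)%C 0 (2 * PI) = (l * RtoC (2 * PI))%C.
Proof.
intros Hr Hf Hl.
assert (Hpi : 0 < 2 * PI) by (assert (T := PI_RGT_0); lra).
set (g := fun w => ((f (z + Cexp w) - f z) / Cexp w)%C).
set (B := ln r).
assert (Hg : diff_halfplane g B).
{ intros x y Hx.
  assert (Hm : Cmod (z + Cexp (x, y) - z)%C < r').
  { replace (z + Cexp (x, y) - z)%C with (Cexp (x, y)) by ring.
    rewrite Cmod_Cexp; simpl. apply Rle_lt_trans with r; [|lra].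
    rewrite <- (exp_ln r) by lra. destruct Hx as [Hx| ->]; [left; now apply exp_increasing|apply Rle_refl]. }
  destruct (Hf _ Hm) as [l' Hl'].
  eexists. apply (Cder_div (fun w => f (z + Cexp w) - f z)%C Cexp).
  - apply Cexp_neq_0.
  - apply Cder_minus; [|apply Cder_const].
    apply (Cder_comp f (fun w => z + Cexp w)%C); [exact Hl'|].
    apply Cder_plus; [apply Cder_const|apply Cder_Cexp].
  - apply Cder_Cexp. }
assert (Hper : forall x y, g (x, (y + 2 * PI)%R) = g (x, y)).
{ intros x y. unfold g, Cexp; simpl. now rewrite cos_plus, sin_plus, cos_2PI, sin_2PI, !Rmult_0_r, !Rmult_1_r, Rminus_0_r, Rplus_0_r. }
set (Phi := fun x => CInt (fun t => g (x, t)) 0 (2 * PI)).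
(* By periodicity the horizontal sides of the square cancel, and Goursat leaves i (Phi (x + 2 pi) -
   Phi x) = 0. *)
assert (HPhi : forall x, x + 2 * PI <= B -> Phi (x + 2 * PI) = Phi x).
{ intros x Hx. assert (Z := square_int_zero g B x 0 (2 * PI) Hg Hpi Hx).
  rewrite (square_int_split g B) in Z; trivial; [|lra].
  rewrite (CInt_ext (fun t => g (t, (0 + 2 * PI)%R)) (fun t => g (t, 0)) x (x + 2 * PI)) in Z
    by (try lra; intros; apply Hper).
  rewrite !Rplus_0_l in Z. fold (Phi x) (Phi (x + 2 * PI)) in Z.
  set (P1 := Phi (x + 2 * PI)) in *.
  replace P1 with (Phi x + - (Ci * (Ci * (P1 - Phi x))))%C.
  - assert (Z' : (Ci * (P1 - Phi x))%C = 0).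
    { rewrite <- Z. ring. }
    rewrite Z'. ring.
  - assert (Hi : (Ci * Ci = - (1))%C) by (unfold Ci, Cmult, Copp, RtoC; simpl; f_equal; ring).
    rewrite Cmult_assoc, Hi. ring. }
assert (HPhin : forall n, Phi B = Phi (B - INR n * (2 * PI))).
{ intros n; induction n as [|n IH].
  - f_equal. simpl; ring.
  - rewrite IH, S_INR. rewrite <- (HPhi (B - (INR n + 1) * (2 * PI))).
    + f_equal; ring.
    + assert (P := pos_INR n). assert (0 <= INR n * (2 * PI)) by nra. lra. }
assert (HB : CInt (fun t => (f (z + circ r t) - f z) / circ r t)%C 0 (2 * PI) = Phi B).
{ apply CInt_ext; [lra|]. intros t _. unfold g, B. now rewrite Cexp_circ by lra. }
rewrite HB.
enough (E : Cmod (Phi B - l * RtoC (2 * PI))%C = 0).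
{ apply Cmod_eq_0 in E. replace (Phi B) with ((Phi B - l * RtoC (2 * PI)) + l * RtoC (2 * PI))%C by ring.
  rewrite E; ring. }
apply Rle_antisym; [|apply Cmod_ge_0].
apply le_epsilon. intros eps He. rewrite Rplus_0_l.
assert (He' : 0 < eps / (4 * PI)) by (apply Rdiv_lt_0_compat; lra).
destruct (Hl _ He') as [d [Hd H]].
(* Far enough to the left the segment maps to a circle so small that the difference quotient is
   uniformly close to l. *)
assert (Hn : exists n, exp (B - INR n * (2 * PI)) < d).
{ destruct (INR_unbounded ((B - ln d) / (2 * PI))) as [n Hn].
  exists n. rewrite <- (exp_ln d) by trivial. apply exp_increasing.
  apply Rlt_div_l in Hn; [lra|trivial]. }
destruct Hn as [n Hn]. rewrite (HPhin n). unfold Phi.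
replace (RtoC (2 * PI)) with (RtoC (2 * PI - 0)) by (f_equal; ring).
replace eps with (2 * (eps / (4 * PI) * (2 * PI - 0))) by (field; apply PI_neq0).
assert (HnB : B - INR n * (2 * PI) <= B).
{ assert (P := pos_INR n). assert (0 <= INR n * (2 * PI)) by nra. lra. }
apply CInt_approx; [lra| |].
- intros t _. now apply (path_cont_vertical g B).
- intros t _. unfold g. set (w := Cexp _).
  assert (Hw : Cmod w < d) by (unfold w; rewrite Cmod_Cexp; exact Hn).
  assert (Hw0 : w <> 0) by apply Cexp_neq_0.
  replace ((f (z + w) - f z) / w - l)%C with ((f (z + w) - f z - l * w) / w)%C by (field; trivial).
  rewrite Cmod_div by trivial. apply Rle_div_l; [now apply Cmod_gt_0|]. now apply H.
Qed.

Lemma Cmod_segment (z0 z w : C) (t r : R) :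
  0 <= t <= 1 -> Cmod (z - z0)%C < r -> Cmod (w - z0)%C < r ->
  Cmod (z + RtoC t * (w - z) - z0)%C < r.
Proof.
intros Ht Hz Hw.
replace (z + RtoC t * (w - z) - z0)%C
  with (RtoC (1 - t) * (z - z0) + RtoC t * (w - z0))%C by (rewrite RtoC_minus; ring).
eapply Rle_lt_trans; [apply Cmod_triangle|].
rewrite !Cmod_mult, !Cmod_R, !Rabs_pos_eq by lra.
destruct (Req_dec t 0); [subst; lra|].
assert (t * Cmod (w - z0) < t * r) by (apply Rmult_lt_compat_l; lra).
assert ((1 - t) * Cmod (z - z0) <= (1 - t) * r) by (apply Rmult_le_compat_l; lra).
lra.
Qed.

Lemma Cmod_dist_triangle (a b c : C) : Cmod (a - c) <= Cmod (a - b) + Cmod (b - c).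
Proof. replace (a - c)%C with ((a - b) + (b - c))%C by ring. apply Cmod_triangle. Qed.

Lemma Cmod_sub_sym (a b : C) : Cmod (a - b) = Cmod (b - a).
Proof. rewrite <- Cmod_opp. f_equal; ring. Qed.

Lemma Cder_ball_lipschitz (f df : C -> C) (z0 : C) (r K : R) :
  (forall w, Cmod (w - z0)%C < r -> Cder f w (df w)) ->
  (forall w, Cmod (w - z0)%C < r -> Cmod (df w) <= K) ->
  forall w w', Cmod (w - z0)%C < r -> Cmod (w' - z0)%C < r ->
  Cmod (f w' - f w)%C <= 2 * K * Cmod (w' - w)%C.
Proof.
intros Hf HK w w' Hw Hw'.
apply (Cder_lipschitz f df); intros t Ht; (apply Hf || apply HK); now apply Cmod_segment.
Qed.

Lemma lipschitz_path_cont (f : C -> C) (z0 c : C) (r K s t : R) :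
  0 <= s -> Cmod (c - z0)%C + s < r ->
  (forall w w', Cmod (w - z0)%C < r -> Cmod (w' - z0)%C < r ->
     Cmod (f w' - f w)%C <= K * Cmod (w' - w)%C) ->
  path_cont (fun u => f (c + circ s u)%C) t.
Proof.
intros Hs Hr HK eps He.
assert (HK' : 0 < Rabs K + 1) by (assert (T := Rabs_pos K); lra).
destruct (path_cont_shift c s t (eps / (Rabs K + 1))) as [d [Hd H]]; [now apply Rdiv_lt_0_compat|].
exists d; split; trivial. intros u Hu. specialize (H u Hu).
assert (Hin : forall v, Cmod (c + circ s v - z0)%C < r).
{ intros v. replace (c + circ s v - z0)%C with ((c - z0) + circ s v)%C by ring.
  eapply Rle_lt_trans; [apply Cmod_triangle|]. rewrite Cmod_circ; lra. }
eapply Rle_lt_trans; [apply HK; apply Hin|].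
set (m := Cmod (c + circ s u - (c + circ s t))%C) in *.
assert (0 <= m) by apply Cmod_ge_0.
apply Rlt_div_r in H; [|trivial].
assert (K * m <= Rabs K * m) by (apply Rmult_le_compat_r; [trivial|apply Rle_abs]). lra.
Qed.

Lemma RtoC_2PI_neq_0 : RtoC (2 * PI) <> 0.
Proof.
apply Cmod_gt_0. rewrite Cmod_R. apply Rabs_pos_lt.
assert (T := PI_RGT_0). lra.
Qed.

(* The circle formula bounds df by f, then (applied to differences) makes f
   and df Lipschitz, and finally differentiates df under the integral. *)
Lemma Cder_derivative_bounded (f df : C -> C) (z0 : C) (r M : R) :
  0 < r ->
  (forall w, Cmod (w - z0)%C < 5 * r -> Cder f w (df w)) ->
  (forall w, Cmod (w - z0)%C < 5 * r -> Cmod (f w) <= M) ->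
  exists l, Cder df z0 l.
Proof.
intros Hr Hf HM.
assert (Hpi : 0 < PI) by apply PI_RGT_0.
assert (Hpi2 : Cmod (RtoC (2 * PI)) = 2 * PI) by (rewrite Cmod_R; apply Rabs_pos_eq; lra).
(* Every use of the circle formula costs one radius r: f is bounded up to 5r, df up to 4r, and df is
   Lipschitz up to 3r. *)
set (G := fun w t => ((f (w + circ r t) - f w) / circ r t)%C).
assert (Hnz : forall t, circ r t <> 0) by (intros; now apply circ_neq_0).
assert (Hcirc : forall w t, Cmod (w + circ r t - z0)%C <= Cmod (w - z0)%C + r).
{ intros w t. replace (w + circ r t - z0)%C with ((w - z0) + circ r t)%C by ring.
  eapply Rle_trans; [apply Cmod_triangle|]. rewrite Cmod_circ; lra. }
assert (HG : forall w, Cmod (w - z0)%C < 4 * r ->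
  CInt (G w) 0 (2 * PI) = (df w * RtoC (2 * PI))%C).
{ intros w Hw. apply (derivative_circle_mean f w (df w) r (5 * r - Cmod (w - z0)%C)); [lra| |apply Hf; lra].
  intros v Hv. exists (df v). apply Hf.
  assert (T := Cmod_dist_triangle v w z0). lra. }
assert (HGc : forall w, Cmod (w - z0)%C < 4 * r -> path_cont_on (G w) 0 (2 * PI)).
{ intros w Hw t _. apply path_cont_div_circ; trivial.
  apply path_cont_minus; [|apply path_cont_const].
  apply (path_cont_comp f (fun s => w + circ r s)%C t (df (w + circ r t)%C)); [|apply path_cont_shift].
  apply Hf. specialize (Hcirc w t). lra. }
set (K1 := 4 * M / r).
assert (HK1 : forall w, Cmod (w - z0)%C < 4 * r -> Cmod (df w) <= K1).
{ intros w Hw.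
  assert (B : Cmod (CInt (G w) 0 (2 * PI)) <= 2 * (2 * M / r * (2 * PI - 0))).
  { apply CInt_bound; [lra|now apply HGc|]. intros t _. unfold G.
    rewrite Cmod_div, Cmod_circ by (trivial; lra).
    apply Rmult_le_compat_r; [left; now apply Rinv_0_lt_compat|].
    unfold Cminus; eapply Rle_trans; [apply Cmod_triangle|]. rewrite Cmod_opp.
    specialize (Hcirc w t).
    assert (B1 := HM w ltac:(lra)). assert (B2 := HM (w + circ r t)%C ltac:(lra)). lra. }
  rewrite HG, Cmod_mult, Hpi2 in B by trivial.
  apply Rmult_le_reg_r with (2 * PI); [lra|].
  eapply Rle_trans; [exact B|]. apply Req_le. unfold K1. field. lra. }
assert (HL1 : forall w w', Cmod (w - z0)%C < 4 * r -> Cmod (w' - z0)%C < 4 * r ->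
   Cmod (f w' - f w)%C <= 2 * K1 * Cmod (w' - w)%C).
{ apply (Cder_ball_lipschitz f df); trivial. intros w Hw; apply Hf; lra. }
set (K2 := 8 * K1 / r).
assert (HK1p : 0 <= K1).
{ eapply Rle_trans; [apply Cmod_ge_0|apply (HK1 z0)].
  replace (z0 - z0)%C with (RtoC 0) by ring. rewrite Cmod_0; lra. }
assert (HL2 : forall w w', Cmod (w - z0)%C < 3 * r -> Cmod (w' - z0)%C < 3 * r ->
   Cmod (df w' - df w)%C <= K2 * Cmod (w' - w)%C).
{ intros w w' Hw Hw'.
  assert (B : Cmod (CInt (fun t => G w' t - G w t)%C 0 (2 * PI))
     <= 2 * (4 * K1 * Cmod (w' - w)%C / r * (2 * PI - 0))).
  { apply CInt_bound; [lra| |].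
    - intros t Ht. apply path_cont_minus; apply HGc; trivial; lra.
    - intros t _. unfold G.
      replace ((f (w' + circ r t) - f w') / circ r t - (f (w + circ r t) - f w) / circ r t)%C
        with (((f (w' + circ r t) - f (w + circ r t)) - (f w' - f w)) / circ r t)%C by (field; trivial).
      rewrite Cmod_div, Cmod_circ by (trivial; lra).
      apply Rmult_le_compat_r; [left; now apply Rinv_0_lt_compat|].
      unfold Cminus at 1; eapply Rle_trans; [apply Cmod_triangle|]. rewrite Cmod_opp.
      assert (C1 := Hcirc w t). assert (C2 := Hcirc w' t).
      assert (B1 := HL1 w w' ltac:(lra) ltac:(lra)).
      assert (B2 := HL1 (w + circ r t)%C (w' + circ r t)%C ltac:(lra) ltac:(lra)).
      replace (w' + circ r t - (w + circ r t))%C with (w' - w)%C in B2 by ring. lra. }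
  rewrite CInt_minus, !HG in B; try lra; try (apply HGc; lra).
  replace (df w' * RtoC (2 * PI) - df w * RtoC (2 * PI))%C
     with ((df w' - df w) * RtoC (2 * PI))%C in B by ring.
  rewrite Cmod_mult, Hpi2 in B.
  apply Rmult_le_reg_r with (2 * PI); [lra|].
  eapply Rle_trans; [exact B|]. apply Req_le. unfold K2. field. lra. }
assert (HK2p : 0 <= K2) by (unfold K2; apply Rmult_le_pos; [lra|left; now apply Rinv_0_lt_compat]).
(* A first-order Taylor bound, uniform in w: after subtracting the linear map v |-> df w * v, the
   derivative df v - df w is at most K2 |h| on the segment. *)
assert (HT : forall w h, Cmod (w - z0)%C < 3 * r -> Cmod (w + h - z0)%C < 3 * r ->
   Cmod (f (w + h) - f w - df w * h)%C <= 2 * K2 * Cmod h ^ 2).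
{ intros w h Hw Hwh.
  assert (B : Cmod ((f (w + h) - df w * (w + h)) - (f w - df w * w))%C
    <= 2 * (K2 * Cmod h) * Cmod (w + h - w)%C).
  { apply (Cder_lipschitz (fun v => f v - df w * v)%C (fun v => df v - df w)%C); intros t Ht;
     assert (Hv := Cmod_segment z0 w (w + h) t (3 * r) Ht Hw Hwh).
    - apply Cder_minus; [apply Hf; lra|].
      apply Cder_eq with (0 * (w + RtoC t * (w + h - w)) + df w * 1)%C; [ring|].
      apply (Cder_mult (fun _ => df w) (fun v => v)); [apply Cder_const|apply Cder_id].
    - eapply Rle_trans; [apply HL2; trivial|].
      apply Rmult_le_compat_l; trivial.
      replace (w + RtoC t * (w + h - w) - w)%C with (RtoC t * h)%C by ring.
      rewrite Cmod_mult, Cmod_R, Rabs_pos_eq by lra. assert (T := Cmod_ge_0 h). nra. }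
  replace (w + h - w)%C with h in B by ring.
  replace (f (w + h) - f w - df w * h)%C with ((f (w + h) - df w * (w + h)) - (f w - df w * w))%C by ring.
  eapply Rle_trans; [exact B|]. apply Req_le; ring. }
(* The integrand that formal differentiation of the circle formula at z0 produces; its mean is the
   candidate for f''(z0). *)
set (Gd := fun t => ((df (z0 + circ r t) - df z0) / circ r t)%C).
assert (Hz0 : Cmod (z0 - z0)%C = 0) by (replace (z0 - z0)%C with (RtoC 0) by ring; apply Cmod_0).
assert (HGd : path_cont_on Gd 0 (2 * PI)).
{ intros t _. apply path_cont_div_circ; trivial.
  apply path_cont_minus; [|apply path_cont_const].
  apply (lipschitz_path_cont df z0 z0 (3 * r) K2); trivial; lra. }
exists (CInt Gd 0 (2 * PI) / RtoC (2 * PI))%C.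
set (D := CInt Gd 0 (2 * PI)).
set (K3 := 8 * K2 / r).
assert (HK3p : 0 <= K3) by (unfold K3; apply Rmult_le_pos; [lra|left; now apply Rinv_0_lt_compat]).
assert (Hq : forall h, Cmod h < r ->
  Cmod (df (z0 + h) - df z0 - D / RtoC (2 * PI) * h)%C <= K3 * Cmod h ^ 2).
{ intros h Hh.
  assert (Hzh : Cmod (z0 + h - z0)%C < r) by (replace (z0 + h - z0)%C with h by ring; trivial).
  assert (B : Cmod (CInt (fun t => (G (z0 + h) t - G z0 t) - h * Gd t)%C 0 (2 * PI))
     <= 2 * (4 * K2 * Cmod h ^ 2 / r * (2 * PI - 0))).
  { apply CInt_bound; [lra| |].
    - intros t Ht. apply path_cont_minus; [apply path_cont_minus; apply HGc; trivial; lra|].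
      apply path_cont_mult; [apply path_cont_const|now apply HGd].
    - intros t _. unfold G, Gd.
      replace ((f (z0 + h + circ r t) - f (z0 + h)) / circ r t - (f (z0 + circ r t) - f z0) / circ r t
         - h * ((df (z0 + circ r t) - df z0) / circ r t))%C
        with (((f (z0 + circ r t + h) - f (z0 + circ r t) - df (z0 + circ r t) * h)
          - (f (z0 + h) - f z0 - df z0 * h)) / circ r t)%C.
      2: { replace (z0 + h + circ r t)%C with (z0 + circ r t + h)%C by ring. field; trivial. }
      rewrite Cmod_div, Cmod_circ by (trivial; lra).
      apply Rmult_le_compat_r; [left; now apply Rinv_0_lt_compat|].
      unfold Cminus at 1; eapply Rle_trans; [apply Cmod_triangle|]. rewrite Cmod_opp.
      assert (C1 := Hcirc z0 t). assert (C2 := Hcirc (z0 + h)%C t).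
      replace (z0 + h + circ r t)%C with (z0 + circ r t + h)%C in C2 by ring.
      assert (B1 := HT z0 h ltac:(lra) ltac:(lra)).
      assert (B2 := HT (z0 + circ r t)%C h ltac:(lra) ltac:(lra)). lra. }
  assert (Hc2 : path_cont_on (fun t => G (z0 + h)%C t - G z0 t)%C 0 (2 * PI)).
  { intros t Ht; apply path_cont_minus; apply HGc; trivial; lra. }
  assert (Hc3 : path_cont_on (fun t => h * Gd t)%C 0 (2 * PI)).
  { intros t Ht; apply path_cont_mult; [apply path_cont_const|now apply HGd]. }
  rewrite (CInt_minus _ (fun t => h * Gd t)%C), CInt_scal, CInt_minus, !HG in B;
    trivial; try lra; try (apply HGc; lra).
  fold D in B.
  replace (df (z0 + h) * RtoC (2 * PI) - df z0 * RtoC (2 * PI) - h * D)%C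
     with ((df (z0 + h) - df z0 - D / RtoC (2 * PI) * h) * RtoC (2 * PI))%C in B
     by (field; apply RtoC_2PI_neq_0).
  rewrite Cmod_mult, Hpi2 in B.
  apply Rmult_le_reg_r with (2 * PI); [lra|].
  eapply Rle_trans; [exact B|]. apply Req_le. unfold K3. field. lra. }
intros eps He.
exists (Rmin r (eps / (K3 + 1))); split; [apply Rmin_glb_lt; [trivial|apply Rdiv_lt_0_compat; lra]|].
intros h Hh. apply Rmin_Rgt_l in Hh as [Hh1 Hh2].
eapply Rle_trans; [apply Hq; exact Hh1|].
apply Rgt_lt, Rlt_div_r in Hh2; [|lra].
assert (T := Cmod_ge_0 h). nra.
Qed.

(** Continuity at z0 already bounds f by |f z0| + 1 nearby, which removes the boundedness hypothesis
    of [Cder_derivative_bounded]. *)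
Lemma Cder_derivative (f df : C -> C) (z0 : C) (rho : R) :
  0 < rho -> (forall w, Cmod (w - z0)%C < rho -> Cder f w (df w)) -> exists l, Cder df z0 l.
Proof.
intros Hrho Hf.
assert (H0 : Cder f z0 (df z0)).
{ apply Hf. replace (z0 - z0)%C with (RtoC 0) by ring. now rewrite Cmod_0. }
destruct (Cder_cont f z0 _ H0 1 Rlt_0_1) as [d [Hd H]].
set (r := Rmin rho d / 5).
assert (Hm : 0 < Rmin rho d) by now apply Rmin_glb_lt.
assert (Hm1 := Rmin_l rho d). assert (Hm2 := Rmin_r rho d).
apply (Cder_derivative_bounded f df z0 r (Cmod (f z0) + 1)); unfold r; [lra| |].
- intros w Hw; apply Hf; lra.
- intros w Hw. assert (Hw' : Cmod (w - z0)%C < d) by lra. specialize (H _ Hw').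
  rewrite Cplus_sub in H. assert (T := Cmod_triangle_rev (f w) (f z0)). lra.
Qed.

(** * Second-order expansions *)

(* For smooth u, the Laplacian at z is 4 k. *)
Definition jet (u : C -> R) (z a b : C) (k : R) : Prop :=
  forall eps, 0 < eps -> exists d, 0 < d /\ forall h, Cmod h < d ->
    Rabs (u (z + h)%C - u z - Re (a * h + b * (h * h))%C - k * Cmod h ^ 2) <= eps * Cmod h ^ 2.

Definition holo_jet (f : C -> C) (z a b : C) : Prop :=
  forall eps, 0 < eps -> exists d, 0 < d /\ forall h, Cmod h < d ->
    Cmod (f (z + h) - f z - (a * h + b * (h * h)))%C <= eps * Cmod h ^ 2.

(** Here q is the second derivative, whereas in [jet] and [holo_jet] the quadratic terms are Taylor
    coefficients; hence the factors 1/2 and 1/4 in the chain rules. *)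
Definition real_jet (phi : R -> R) (t p q : R) : Prop :=
  forall eps, 0 < eps -> exists d, 0 < d /\ forall s, Rabs s < d ->
    Rabs (phi (t + s) - phi t - (p * s + q / 2 * s ^ 2)) <= eps * s ^ 2.

Definition has_laplacian (u : C -> R) (z : C) (k : R) : Prop :=
  exists a b, jet u z a b k.

Lemma jet_plus (u v : C -> R) (z a b a' b' : C) (k k' : R) :
  jet u z a b k -> jet v z a' b' k' ->
  jet (fun w => u w + v w) z (a + a')%C (b + b')%C (k + k').
Proof.
intros Hu Hv eps He.
destruct (Hu (eps / 2) ltac:(lra)) as [d1 [Hd1 H1]].
destruct (Hv (eps / 2) ltac:(lra)) as [d2 [Hd2 H2]].
exists (Rmin d1 d2); split; [now apply Rmin_glb_lt|].
intros h Hh. apply Rmin_Rgt_l in Hh as [Hh1 Hh2].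
specialize (H1 h Hh1). specialize (H2 h Hh2).
replace (Re ((a + a') * h + (b + b') * (h * h))%C)
  with (Re (a * h + b * (h * h))%C + Re (a' * h + b' * (h * h))%C)
  by (unfold Re, Cplus, Cmult; simpl; ring).
set (A := Re (a * h + b * (h * h))%C) in *. set (A' := Re (a' * h + b' * (h * h))%C) in *.
replace (u (z + h)%C + v (z + h)%C - (u z + v z) - (A + A') - (k + k') * Cmod h ^ 2)
  with ((u (z + h)%C - u z - A - k * Cmod h ^ 2) + (v (z + h)%C - v z - A' - k' * Cmod h ^ 2)) by ring.
eapply Rle_trans; [apply Rabs_triang|]. lra.
Qed.

Lemma has_laplacian_plus (u v : C -> R) (z : C) (k k' : R) :
  has_laplacian u z k -> has_laplacian v z k' -> has_laplacian (fun w => u w + v w) z (k + k').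
Proof.
intros [a [b H]] [a' [b' H']]. eexists; eexists; now apply jet_plus; [apply H|apply H'].
Qed.

Lemma Rabs_sq_diff (x y : C) : Rabs (Cmod x ^ 2 - Cmod y ^ 2) <= Cmod (x - y) * (Cmod x + Cmod y).
Proof.
replace (Cmod x ^ 2 - Cmod y ^ 2) with ((Cmod x - Cmod y) * (Cmod x + Cmod y)) by ring.
assert (Hx := Cmod_ge_0 x). assert (Hy := Cmod_ge_0 y).
rewrite Rabs_mult, (Rabs_pos_eq (Cmod x + Cmod y)) by lra.
apply Rmult_le_compat_r; [lra|].
apply Rabs_le; split; [|apply Cmod_triangle_rev].
assert (T := Cmod_triangle_rev y x). rewrite Cmod_sub_sym in T. lra.
Qed.

(** The increment s of f has no conjugate terms: a s + b s^2 stays a holomorphic quadratic in h, and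
    |s|^2 = |a'|^2 |h|^2 up to higher order. So the Laplacian is just scaled by |f'|^2. *)
Lemma jet_comp_holo (u : C -> R) (f : C -> C) (z a b a' b' : C) (k : R) :
  jet u (f z) a b k -> holo_jet f z a' b' ->
  jet (fun w => u (f w)) z (a * a')%C (a * b' + b * (a' * a'))%C (k * Cmod a' ^ 2).
Proof.
intros Hu Hf eps He.
(* M bounds |s| / |h| for the increment s of f, and S collects the coefficients of e in the total
   error. *)
set (M := Cmod a' + Cmod b' + 1).
set (S := M ^ 2 + Cmod a + 2 * M ^ 2 * (Cmod b + Rabs k)).
assert (Pa := Cmod_ge_0 a). assert (Pb := Cmod_ge_0 b).
assert (Pa' := Cmod_ge_0 a'). assert (Pb' := Cmod_ge_0 b'). assert (Pk := Rabs_pos k).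
assert (HM : 1 <= M) by (unfold M; lra).
assert (HS : 1 <= S) by (unfold S; assert (1 <= M ^ 2) by nra; nra).
set (e := Rmin 1 (eps / S)).
assert (He0 : 0 < e) by (apply Rmin_glb_lt; [lra|apply Rdiv_lt_0_compat; lra]).
assert (He1 : e <= 1) by apply Rmin_l.
assert (HeS : e * S <= eps) by (apply Rle_div_r; [lra|apply Rmin_r]).
destruct (Hu e He0) as [d1 [Hd1 H1]].
destruct (Hf e He0) as [d2 [Hd2 H2]].
exists (Rmin e (Rmin d2 (d1 / M))); split.
{ apply Rmin_glb_lt; [trivial|apply Rmin_glb_lt; [trivial|apply Rdiv_lt_0_compat; lra]]. }
intros h Hh. apply Rmin_Rgt_l in Hh as [Hh1 Hh]. apply Rmin_Rgt_l in Hh as [Hh2 Hh3].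
assert (Ph := Cmod_ge_0 h).
specialize (H2 h Hh2).
set (s := (f (z + h) - f z)%C) in *.
assert (Hsf : (f (z + h)%C = f z + s)%C) by (unfold s; ring).
rewrite Hsf.
set (rho := (s - (a' * h + b' * (h * h)))%C) in *.
assert (E1 : Cmod (s - a' * h)%C <= M * Cmod h ^ 2).
{ replace (s - a' * h)%C with (rho + b' * (h * h))%C by (unfold rho; ring).
  eapply Rle_trans; [apply Cmod_triangle|]. rewrite !Cmod_mult. unfold M.
  assert (0 <= Cmod h ^ 2) by nra. nra. }
assert (E2 : Cmod s <= M * Cmod h).
{ replace s with (rho + (a' * h + b' * (h * h)))%C by (unfold rho; ring).
  eapply Rle_trans; [apply Cmod_triangle|].
  eapply Rle_trans; [apply Rplus_le_compat; [exact H2|apply Cmod_triangle]|].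
  rewrite !Cmod_mult. unfold M.
  assert (Cmod h * Cmod h <= Cmod h) by nra.
  assert (e * Cmod h ^ 2 <= Cmod h) by nra.
  assert (Cmod b' * (Cmod h * Cmod h) <= Cmod b' * Cmod h) by (apply Rmult_le_compat_l; lra). lra. }
assert (Hs1 : Cmod s < d1).
{ apply Rgt_lt, Rlt_div_r in Hh3; [|lra]. lra. }
specialize (H1 s Hs1).
assert (E3 : Cmod (a' * h) <= M * Cmod h).
{ rewrite Cmod_mult. apply Rmult_le_compat_r; unfold M; lra. }
assert (Hs0 := Cmod_ge_0 s).
assert (F1 : Rabs (Cmod s ^ 2 - Cmod (a' * h) ^ 2) <= 2 * M ^ 2 * Cmod h * Cmod h ^ 2).
{ eapply Rle_trans; [apply Rabs_sq_diff|].
  apply Rle_trans with (M * Cmod h ^ 2 * (M * Cmod h + M * Cmod h)); [|apply Req_le; ring].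
  apply Rmult_le_compat; try lra; [apply Cmod_ge_0|].
  assert (T := Cmod_ge_0 (a' * h)). lra. }
assert (F2 : Cmod (s * s - (a' * h) * (a' * h))%C <= 2 * M ^ 2 * Cmod h * Cmod h ^ 2).
{ replace (s * s - (a' * h) * (a' * h))%C with ((s - a' * h) * (s + a' * h))%C by ring.
  rewrite Cmod_mult.
  apply Rle_trans with (M * Cmod h ^ 2 * (M * Cmod h + M * Cmod h)); [|apply Req_le; ring].
  apply Rmult_le_compat; try apply Cmod_ge_0; trivial.
  eapply Rle_trans; [apply Cmod_triangle|]. lra. }
replace (u (f z + s)%C - u (f z) -
   Re (a * a' * h + (a * b' + b * (a' * a')) * (h * h))%C - k * Cmod a' ^ 2 * Cmod h ^ 2)
 with ((u (f z + s)%C - u (f z) - Re (a * s + b * (s * s))%C - k * Cmod s ^ 2)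
   + (Re (a * rho + b * (s * s - a' * h * (a' * h)))%C + k * (Cmod s ^ 2 - Cmod (a' * h) ^ 2))).
2: { replace (a * a' * h + (a * b' + b * (a' * a')) * (h * h))%C
       with ((a * s + b * (s * s)) - (a * rho + b * (s * s - a' * h * (a' * h))))%C
       by (unfold rho; ring).
     rewrite Cmod_mult. unfold Re, Cminus, Cplus, Copp; simpl. ring. }
eapply Rle_trans; [apply Rabs_triang|].
eapply Rle_trans; [apply Rplus_le_compat; [exact H1|apply Rabs_triang]|].
rewrite Rabs_mult.
assert (G1 : Rabs (Re (a * rho + b * (s * s - a' * h * (a' * h)))%C)
  <= Cmod a * (e * Cmod h ^ 2) + Cmod b * (2 * M ^ 2 * Cmod h * Cmod h ^ 2)).
{ eapply Rle_trans; [apply re_le_Cmod|]. eapply Rle_trans; [apply Cmod_triangle|].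
  rewrite !(Cmod_mult a), !(Cmod_mult b).
  apply Rplus_le_compat; apply Rmult_le_compat_l; trivial. }
assert (G2 : Rabs k * Rabs (Cmod s ^ 2 - Cmod (a' * h) ^ 2) <= Rabs k * (2 * M ^ 2 * Cmod h * Cmod h ^ 2)).
{ now apply Rmult_le_compat_l. }
assert (G3 : e * Cmod s ^ 2 <= e * (M ^ 2 * Cmod h ^ 2)).
{ apply Rmult_le_compat_l; [lra|]. rewrite <- Rpow_mult_distr. apply pow_incr; lra. }
assert (G4 : Cmod h * (2 * M ^ 2 * Cmod h ^ 2 * (Cmod b + Rabs k)) <= e * (2 * M ^ 2 * Cmod h ^ 2 * (Cmod b + Rabs k))).
{ apply Rmult_le_compat_r; [|lra]. assert (0 <= M ^ 2 * Cmod h ^ 2) by (apply Rmult_le_pos; nra). nra. }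
apply Rle_trans with (e * S * Cmod h ^ 2).
- unfold S. lra.
- apply Rmult_le_compat_r; [nra|trivial].
Qed.

Lemma has_laplacian_comp_holo (u : C -> R) (f : C -> C) (z a b : C) (k : R) :
  has_laplacian u (f z) k -> holo_jet f z a b ->
  has_laplacian (fun w => u (f w)) z (k * Cmod a ^ 2).
Proof.
intros [a' [b' H]] Hf. eexists; eexists; apply jet_comp_holo; [apply H|apply Hf].
Qed.

Lemma Re_sq (x : C) : Re x ^ 2 = (Cmod x ^ 2 + Re (x * x)%C) / 2.
Proof. rewrite Cmod2_alt. unfold Re, Im, Cmult; simpl. field. Qed.

(** By [Re_sq], the new term q/2 (Re (a h))^2 splits into the harmonic part q/4 Re (a^2 h^2) and q/4
    |a|^2 |h|^2, which goes to the Laplacian. *)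
Lemma jet_comp_real (u : C -> R) (phi : R -> R) (z a b : C) (k p q : R) :
  jet u z a b k -> real_jet phi (u z) p q ->
  jet (fun w => phi (u w)) z (RtoC p * a)%C (RtoC p * b + RtoC (q / 4) * (a * a))%C
    (p * k + q * Cmod a ^ 2 / 4).
Proof.
intros Hu Hphi eps He.
set (M := Cmod a + Cmod b + Rabs k + 1).
set (S := M ^ 2 + Rabs p + M ^ 2 * Rabs q).
assert (Pa := Cmod_ge_0 a). assert (Pb := Cmod_ge_0 b).
assert (Pk := Rabs_pos k). assert (Pp := Rabs_pos p). assert (Pq := Rabs_pos q).
assert (HM : 1 <= M) by (unfold M; lra).
assert (HS : 1 <= S) by (unfold S; assert (1 <= M ^ 2) by nra; nra).
set (e := Rmin 1 (eps / S)).
assert (He0 : 0 < e) by (apply Rmin_glb_lt; [lra|apply Rdiv_lt_0_compat; lra]).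
assert (He1 : e <= 1) by apply Rmin_l.
assert (HeS : e * S <= eps) by (apply Rle_div_r; [lra|apply Rmin_r]).
destruct (Hphi e He0) as [d1 [Hd1 H1]].
destruct (Hu e He0) as [d2 [Hd2 H2]].
exists (Rmin e (Rmin d2 (d1 / M))); split.
{ apply Rmin_glb_lt; [trivial|apply Rmin_glb_lt; [trivial|apply Rdiv_lt_0_compat; lra]]. }
intros h Hh. apply Rmin_Rgt_l in Hh as [Hh1 Hh]. apply Rmin_Rgt_l in Hh as [Hh2 Hh3].
assert (Ph := Cmod_ge_0 h).
specialize (H2 h Hh2).
set (s := u (z + h)%C - u z) in *.
assert (Hsf : u (z + h)%C = u z + s) by (unfold s; ring).
rewrite Hsf.
set (rho := s - Re (a * h + b * (h * h))%C - k * Cmod h ^ 2) in *.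
assert (R1 : Rabs (Re (a * h)%C) <= Cmod a * Cmod h) by (rewrite <- Cmod_mult; apply re_le_Cmod).
assert (R2 : Rabs (Re (b * (h * h))%C) <= Cmod b * Cmod h ^ 2).
{ eapply Rle_trans; [apply re_le_Cmod|]. rewrite !Cmod_mult. apply Req_le; ring. }
assert (R3 : Rabs (k * Cmod h ^ 2) = Rabs k * Cmod h ^ 2).
{ rewrite Rabs_mult, (Rabs_pos_eq (Cmod h ^ 2)); trivial; nra. }
set (x := Re (a * h)%C) in *. set (y := Re (b * (h * h))%C) in *.
assert (Es : s = x + (y + (k * Cmod h ^ 2 + rho))).
{ unfold rho, x, y. unfold Re, Cplus; simpl. ring. }
assert (P2 : 0 <= Cmod h ^ 2) by nra.
assert (E1 : Rabs (s - x) <= M * Cmod h ^ 2).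
{ replace (s - x) with (y + (k * Cmod h ^ 2 + rho)) by (rewrite Es; ring).
  eapply Rle_trans; [apply Rabs_triang|].
  eapply Rle_trans; [apply Rplus_le_compat_l, Rabs_triang|]. unfold M. nra. }
assert (E3 : Rabs x <= M * Cmod h).
{ eapply Rle_trans; [exact R1|]. apply Rmult_le_compat_r; unfold M; lra. }
assert (E2 : Rabs s <= M * Cmod h).
{ rewrite Es.
  eapply Rle_trans; [apply Rabs_triang|].
  eapply Rle_trans; [apply Rplus_le_compat_l, Rabs_triang|].
  eapply Rle_trans; [apply Rplus_le_compat_l, Rplus_le_compat_l, Rabs_triang|].
  rewrite R3. unfold M.
  assert (Hhh : Cmod h ^ 2 <= Cmod h) by nra.
  assert (e * Cmod h ^ 2 <= Cmod h) by nra.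
  assert (Cmod b * Cmod h ^ 2 <= Cmod b * Cmod h) by (apply Rmult_le_compat_l; lra).
  assert (Rabs k * Cmod h ^ 2 <= Rabs k * Cmod h) by (apply Rmult_le_compat_l; lra). lra. }
assert (Hs1 : Rabs s < d1).
{ apply Rgt_lt, Rlt_div_r in Hh3; [|lra]. lra. }
specialize (H1 s Hs1).
assert (F1 : Rabs (s ^ 2 - x ^ 2) <= 2 * M ^ 2 * Cmod h * Cmod h ^ 2).
{ replace (s ^ 2 - x ^ 2) with ((s - x) * (s + x)) by ring. rewrite Rabs_mult.
  apply Rle_trans with (M * Cmod h ^ 2 * (M * Cmod h + M * Cmod h)); [|apply Req_le; ring].
  apply Rmult_le_compat; try apply Rabs_pos; trivial.
  eapply Rle_trans; [apply Rabs_triang|]. lra. }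
assert (Ex : x ^ 2 = (Cmod a ^ 2 * Cmod h ^ 2 + Re (a * a * (h * h))%C) / 2).
{ unfold x. rewrite Re_sq, Cmod_mult, Rpow_mult_distr.
  now replace (a * h * (a * h))%C with (a * a * (h * h))%C by ring. }
replace (phi (u z + s) - phi (u z) - Re (RtoC p * a * h + (RtoC p * b + RtoC (q / 4) * (a * a)) * (h * h))%C
    - (p * k + q * Cmod a ^ 2 / 4) * Cmod h ^ 2)
 with ((phi (u z + s) - phi (u z) - (p * s + q / 2 * s ^ 2))
   + (p * rho + q / 2 * (s ^ 2 - x ^ 2))).
2: { replace (Re (RtoC p * a * h + (RtoC p * b + RtoC (q / 4) * (a * a)) * (h * h))%C)
       with (p * x + p * y + q / 4 * Re (a * a * (h * h))%C)
       by (unfold x, y, Re, Cplus, Cmult, RtoC; simpl; ring).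
     assert (Er : rho = s - x - y - k * Cmod h ^ 2) by (rewrite Es at 1; ring).
     rewrite Er, Ex. field. }
eapply Rle_trans; [apply Rabs_triang|].
eapply Rle_trans; [apply Rplus_le_compat; [exact H1|apply Rabs_triang]|].
rewrite !Rabs_mult.
assert (G1 : Rabs p * Rabs rho <= Rabs p * (e * Cmod h ^ 2)) by now apply Rmult_le_compat_l.
assert (Hq2 : Rabs (q / 2) = Rabs q / 2).
{ unfold Rdiv. rewrite Rabs_mult, (Rabs_pos_eq (/ 2)); lra. }
rewrite Hq2.
assert (G2 : Rabs q / 2 * Rabs (s ^ 2 - x ^ 2) <= Rabs q / 2 * (2 * M ^ 2 * Cmod h * Cmod h ^ 2)).
{ apply Rmult_le_compat_l; [lra|trivial]. }
assert (G3 : e * s ^ 2 <= e * (M ^ 2 * Cmod h ^ 2)).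
{ apply Rmult_le_compat_l; [lra|]. rewrite <- Rpow_mult_distr, <- (pow2_abs s).
  apply pow_incr. split; [apply Rabs_pos|trivial]. }
assert (G4 : Cmod h * (M ^ 2 * Cmod h ^ 2 * Rabs q) <= e * (M ^ 2 * Cmod h ^ 2 * Rabs q)).
{ apply Rmult_le_compat_r; [|lra]. assert (0 <= M ^ 2 * Cmod h ^ 2) by (apply Rmult_le_pos; nra). nra. }
apply Rle_trans with (e * S * Cmod h ^ 2).
- unfold S. lra.
- apply Rmult_le_compat_r; trivial.
Qed.

Lemma jet_Cmod_sq (z : C) : jet (fun w => Cmod w ^ 2) z (2 * Cconj z)%C 0 1.
Proof.
intros eps He. exists 1; split; [lra|]. intros h _.
replace (Cmod (z + h) ^ 2 - Cmod z ^ 2 - Re (2 * Cconj z * h + 0 * (h * h))%C - 1 * Cmod h ^ 2) with 0.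
- rewrite Rabs_R0. assert (T := Cmod_ge_0 h). nra.
- rewrite !Cmod2_alt. unfold Re, Im, Cplus, Cmult, Cconj, RtoC; simpl. ring.
Qed.

(** The remainder, as a function of x, has derivative dphi (t + x) - dphi t - q x, at most eps |s|
    for |x| <= |s|; the mean value inequality then gives eps s^2. *)
Lemma real_jet_deriv (phi dphi : R -> R) (t q d : R) :
  0 < d -> (forall s, Rabs (s - t) < d -> derivable_pt_lim phi s (dphi s)) ->
  derivable_pt_lim dphi t q -> real_jet phi t (dphi t) q.
Proof.
intros Hd Hphi Hq eps He.
destruct (derivable_pt_lim_approx dphi t q Hq eps He) as [d' [Hd' H]].
exists (Rmin d d'); split; [now apply Rmin_glb_lt|].
intros s Hs. apply Rmin_Rgt_l in Hs as [Hs1 Hs2].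
assert (B := bounded_variation (fun x => phi (t + x) - (dphi t * x + q / 2 * x ^ 2))
  (fun x => dphi (t + x) - dphi t - q * x) (eps * Rabs s) 0 s).
simpl in B. rewrite Rminus_0_r in B.
replace (phi (t + s) - (dphi t * s + q / 2 * (s * (s * 1))) -
       (phi (t + 0) - (dphi t * 0 + q / 2 * (0 * (0 * 1))))) with
  (phi (t + s) - phi t - (dphi t * s + q / 2 * s ^ 2)) in B by (rewrite Rplus_0_r; ring).
rewrite <- (pow2_abs s) at 2. replace (eps * Rabs s ^ 2) with (eps * Rabs s * Rabs s) by ring.
apply B. intros x Hx. rewrite Rminus_0_r in Hx. split.
- apply is_derive_Reals.
  replace (dphi (t + x) - dphi t - q * x) with (dphi (t + x) * 1 - (dphi t + q * x)) by ring.
  apply derivable_pt_lim_minus.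
  + apply (derivable_pt_lim_comp (fun y => t + y) phi x 1).
    * replace 1 with (0 + 1) by ring. apply derivable_pt_lim_plus;
      [apply derivable_pt_lim_const|apply derivable_pt_lim_id].
    * apply Hphi. replace (t + x - t) with x by ring. lra.
  + apply is_derive_Reals. auto_derive; [trivial|field].
- eapply Rle_trans; [apply H; lra|]. apply Rmult_le_compat_l; lra.
Qed.

Lemma holo_jet_deriv (f df : C -> C) (z l : C) (d : R) :
  0 < d -> (forall w, Cmod (w - z)%C < d -> Cder f w (df w)) ->
  Cder df z l -> holo_jet f z (df z) (l / 2)%C.
Proof.
intros Hd Hf Hl eps He.
(* Half of eps pays for the factor 2 of [Cder_lipschitz]. *)
destruct (Hl (eps / 2) ltac:(lra)) as [d' [Hd' H]].
exists (Rmin d d'); split; [now apply Rmin_glb_lt|].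
intros h Hh. apply Rmin_Rgt_l in Hh as [Hh1 Hh2].
assert (Hseg : forall t, 0 <= t <= 1 -> Cmod (RtoC t * h) <= Cmod h).
{ intros t Ht. rewrite Cmod_mult, Cmod_R, Rabs_pos_eq by lra. assert (T := Cmod_ge_0 h). nra. }
set (P := fun w : C => (df z * (w - z) + l / 2 * ((w - z) * (w - z)))%C).
assert (B : Cmod ((f (z + h) - P (z + h)) - (f z - P z))%C
   <= 2 * (eps / 2 * Cmod h) * Cmod (z + h - z)%C).
{ apply (Cder_lipschitz (fun w => f w - P w)%C (fun w => df w - df z - l * (w - z))%C);
  intros t Ht; replace (z + RtoC t * (z + h - z))%C with (z + RtoC t * h)%C by ring;
  specialize (Hseg t Ht).
  - set (w := (z + RtoC t * h)%C).
    apply Cder_eq with (df w - (df z + l * (w - z)))%C; [ring|].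
    apply Cder_minus.
    + apply Hf. unfold w. replace (z + RtoC t * h - z)%C with (RtoC t * h)%C by ring. lra.
    + assert (D1 : Cder (fun v => v - z)%C w 1).
      { apply Cder_eq with (1 - 0)%C; [ring|]. apply Cder_minus; [apply Cder_id|apply Cder_const]. }
      assert (Dc : forall c : C, Cder (fun _ => c) w 0) by (intros; apply Cder_const).
      apply Cder_eq with ((0 * (w - z) + df z * 1)
        + (0 * ((w - z) * (w - z)) + l / 2 * (1 * (w - z) + (w - z) * 1)))%C.
      * assert (E2 : RtoC 2 <> 0) by (intros E; injection E; lra). field. trivial.
      * apply Cder_plus.
        -- now apply (Cder_mult (fun _ => df z) (fun v => v - z)%C).
        -- apply (Cder_mult (fun _ => l / 2)%C (fun v => (v - z) * (v - z))%C); trivial.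
           now apply (Cder_mult (fun v => v - z)%C (fun v => v - z)%C).
  - replace (z + RtoC t * h - z)%C with (RtoC t * h)%C by ring.
    eapply Rle_trans; [apply H; lra|]. apply Rmult_le_compat_l; lra. }
replace (z + h - z)%C with h in B by ring.
replace (f (z + h) - P (z + h) - (f z - P z))%C with
  (f (z + h) - f z - (df z * h + l / 2 * (h * h)))%C in B.
2: { unfold P. replace (z + h - z)%C with h by ring. ring. }
eapply Rle_trans; [exact B|]. apply Req_le; field.
Qed.

Lemma jet_ln_Cmod_sq (z : C) : z <> 0 ->
  exists a b, Cmod a ^ 2 = 4 / Cmod z ^ 2 /\ jet (fun w => ln (Cmod w ^ 2)) z a b 0.
Proof.
intros Hz. assert (Hm : 0 < Cmod z) by now apply Cmod_gt_0.
assert (Hs : 0 < Cmod z ^ 2) by now apply pow_lt.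
assert (Hj : real_jet ln (Cmod z ^ 2) (/ Cmod z ^ 2) (- / (Cmod z ^ 2) ^ 2)).
{ apply (real_jet_deriv ln Rinv _ _ (Cmod z ^ 2)); trivial.
  - intros s Hs'. apply derivable_pt_lim_ln. apply Rabs_lt_between in Hs'. lra.
  - apply is_derive_Reals. auto_derive; [lra|]. field. lra. }
assert (J := jet_comp_real _ _ _ _ _ _ _ _ (jet_Cmod_sq z) Hj).
assert (Ec : Cmod (2 * Cconj z) ^ 2 = 4 * Cmod z ^ 2).
{ rewrite Cmod_mult, Cmod_conj, Cmod_R, Rabs_pos_eq by lra. ring. }
eexists; eexists; split; [|replace 0 with (/ Cmod z ^ 2 * 1 + - / (Cmod z ^ 2) ^ 2 * Cmod (2 * Cconj z) ^ 2 / 4)].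
2: exact J.
- rewrite Cmod_mult, Rpow_mult_distr, Ec, Cmod_R, Rabs_pos_eq by (left; now apply Rinv_0_lt_compat).
  field. lra.
- rewrite Ec. field. lra.
Qed.

(** Since ln |w|^2 is harmonic off 0, the first derivative p does not contribute; the gradient
    recorded in [jet_ln_Cmod_sq] gives the factor 1 / |z|^2. This is why radial densities below are
    written in the variable ln |w|^2. *)
Lemma has_laplacian_radial (phi : R -> R) (z : C) (p q : R) :
  z <> 0 -> real_jet phi (ln (Cmod z ^ 2)) p q ->
  has_laplacian (fun w => phi (ln (Cmod w ^ 2))) z (q / Cmod z ^ 2).
Proof.
intros Hz Hphi.
assert (Hm : 0 < Cmod z) by now apply Cmod_gt_0.
destruct (jet_ln_Cmod_sq z Hz) as [a [b [Ea J]]].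
assert (J' := jet_comp_real _ _ _ _ _ _ _ _ J Hphi).
eexists; eexists. replace (q / Cmod z ^ 2) with (p * 0 + q * Cmod a ^ 2 / 4); [exact J'|].
rewrite Ea. field. lra.
Qed.

(** Up to the constant ln r, the function is minus the logarithm of the hyperbolic density of the
    disk of radius r; the value says that this density has curvature -4. *)
Lemma has_laplacian_ln_disk (r : R) (z : C) : Cmod z < r ->
  has_laplacian (fun w => ln (r ^ 2 - Cmod w ^ 2)) z (- (r / (r ^ 2 - Cmod z ^ 2)) ^ 2).
Proof.
intros Hz. assert (Hm := Cmod_ge_0 z).
assert (Hs : 0 < r ^ 2 - Cmod z ^ 2) by nra.
set (s := Cmod z ^ 2) in *.
assert (Hj : real_jet (fun t => ln (r ^ 2 - t)) s (- / (r ^ 2 - s)) (- / (r ^ 2 - s) ^ 2)).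
{ apply (real_jet_deriv (fun t => ln (r ^ 2 - t)) (fun t => - / (r ^ 2 - t)) _ _ (r ^ 2 - s)); trivial.
  - intros t Ht. apply Rabs_lt_between in Ht.
    apply is_derive_Reals. auto_derive; [lra|]. field; lra.
  - apply is_derive_Reals. auto_derive; [lra|]. field. lra. }
assert (J := jet_comp_real _ _ _ _ _ _ _ _ (jet_Cmod_sq z) Hj).
eexists; eexists.
replace (- (r / (r ^ 2 - s)) ^ 2) with (- / (r ^ 2 - s) * 1 + - / (r ^ 2 - s) ^ 2 * Cmod (2 * Cconj z) ^ 2 / 4);
 [exact J|].
rewrite Cmod_mult, Cmod_conj, Cmod_R, Rabs_pos_eq by lra.
rewrite Rpow_mult_distr. fold s. field. lra.
Qed.

(* Averaging over h, ih, -h, -ih kills the terms Re (a h + b h^2). *)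
Lemma laplacian_at_max (u : C -> R) (z : C) (k d : R) :
  has_laplacian u z k -> 0 < d -> (forall h, Cmod h < d -> u (z + h)%C <= u z) -> k <= 0.
Proof.
intros [a [b H]] Hd Hmax.
destruct (Rle_lt_dec k 0) as [|Hk]; trivial; exfalso.
destruct (H (k / 2) ltac:(lra)) as [d' [Hd' H']].
set (m := Rmin d d').
assert (Hm : 0 < m) by now apply Rmin_glb_lt.
set (s := m / 2). assert (Hs : 0 < s) by (unfold s; lra).
assert (Hsd : s < d /\ s < d').
{ assert (T1 := Rmin_l d d'). assert (T2 := Rmin_r d d'). fold m in T1, T2. unfold s; lra. }
assert (B : forall c : C, Cmod c = 1 ->
   k / 2 * s ^ 2 + Re (a * (c * RtoC s) + b * ((c * RtoC s) * (c * RtoC s)))%C <= 0).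
{ intros c Hc.
  assert (Hcs : Cmod (c * RtoC s) = s) by (rewrite Cmod_mult, Cmod_R, Hc, Rabs_pos_eq; lra).
  specialize (Hmax (c * RtoC s)%C ltac:(lra)). specialize (H' (c * RtoC s)%C ltac:(lra)).
  rewrite Hcs in H'. apply Rabs_le_between in H'. lra. }
assert (B1 := B 1 Cmod_1). assert (B2 := B (- (1))%C Cmod_m1).
assert (B3 := B Ci Cmod_Ci). assert (B4 := B (- Ci)%C).
rewrite Cmod_opp in B4. specialize (B4 Cmod_Ci).
assert (E : Re (a * (1 * RtoC s) + b * ((1 * RtoC s) * (1 * RtoC s)))%C
 + Re (a * (- (1) * RtoC s) + b * ((- (1) * RtoC s) * (- (1) * RtoC s)))%C
 + Re (a * (Ci * RtoC s) + b * ((Ci * RtoC s) * (Ci * RtoC s)))%C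
 + Re (a * (- Ci * RtoC s) + b * ((- Ci * RtoC s) * (- Ci * RtoC s)))%C = 0).
{ unfold Re, Ci, Cplus, Cmult, Copp, RtoC; simpl. ring. }
assert (0 < k / 2 * s ^ 2) by (apply Rmult_lt_0_compat; [lra|now apply pow_lt]).
lra.
Qed.

(** * Ahlfors' lemma *)

(** A single gauge [delta] encodes both the local radius and the local bound 1 / delta, so the
    uniform lower bound d given by compactness of a rectangle yields the global bound 1 / d. Points
    outside P are harmless because the complement is open. *)
Lemma locally_bounded_on_compact (P : C -> Prop) (v : C -> R) (M : R) :
  (forall z, P z -> Cmod z <= M) ->
  (forall z, ~ P z -> exists d, 0 < d /\ forall h, Cmod h < d -> ~ P (z + h)%C) ->
  (forall z, P z -> exists d B, 0 < d /\ forall h, Cmod h < d -> P (z + h)%C -> v (z + h)%C <= B) ->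
  exists B, forall z, P z -> v z <= B.
Proof.
intros HM Hcl Hbd.
assert (Hdelta : forall x y : R, exists d : posreal, forall h, Cmod h < 2 * d ->
   P ((x, y) + h)%C -> v ((x, y) + h)%C <= / d).
{ intros x y. destruct (excluded_middle_informative (P (x, y))) as [HP|HP].
  - destruct (Hbd _ HP) as [d [B [Hd H]]].
    assert (HB : 0 < Rabs B + 1) by (assert (T := Rabs_pos B); lra).
    assert (Hm : 0 < Rmin (d / 2) (/ (Rabs B + 1))).
    { apply Rmin_glb_lt; [lra|now apply Rinv_0_lt_compat]. }
    exists (mkposreal _ Hm). simpl. intros h Hh HPh.
    assert (T1 := Rmin_l (d / 2) (/ (Rabs B + 1))).
    assert (T2 := Rmin_r (d / 2) (/ (Rabs B + 1))).
    apply Rle_trans with B; [apply H; trivial; lra|].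
    apply Rle_trans with (Rabs B + 1); [assert (T := Rle_abs B); lra|].
    apply (Rinv_le_contravar _ _ Hm) in T2. now rewrite Rinv_inv in T2.
  - destruct (Hcl _ HP) as [d [Hd H]].
    assert (Hm : 0 < d / 2) by lra.
    exists (mkposreal _ Hm). simpl. intros h Hh HPh. exfalso; apply (H h); trivial; lra. }
set (delta := fun x y => proj1_sig (constructive_indefinite_description _ (Hdelta x y))).
destruct (compactness_value_2d (- M) M (- M) M delta) as [d Hd].
exists (/ d). intros [x y] HP.
assert (Hxy := HM _ HP).
assert (Hx : - M <= x <= M).
{ apply Rabs_le_between. eapply Rle_trans; [apply (re_le_Cmod (x, y))|trivial]. }
assert (Hy : - M <= y <= M).
{ apply Rabs_le_between. eapply Rle_trans; [apply (im_le_Cmod (x, y))|trivial]. }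
specialize (Hd x y Hx Hy). apply NNPP in Hd.
destruct Hd as [u [w [_ [_ [Hu [Hw Hduw]]]]]].
unfold delta in Hu, Hw, Hduw.
destruct (constructive_indefinite_description _ (Hdelta u w)) as [e He]; simpl in Hu, Hw, Hduw.
apply Rle_trans with (/ e); [|apply Rinv_le_contravar; [apply cond_pos|trivial]].
assert (T : Cmod ((x, y) - (u, w))%C < 2 * e).
{ eapply Rle_lt_trans; [apply Cmod_le_abs_sum|].
  change (Rabs (x - u) + Rabs (y - w) < 2 * e). lra. }
specialize (He _ T). rewrite Cplus_sub in He. auto.
Qed.

(** If the supremum S were not attained, 1 / (S - v) would be locally bounded by semicontinuity,
    hence bounded by some B', and S - 1/B' would be a smaller upper bound. *)
Lemma max_on_compact (P : C -> Prop) (v : C -> R) (M : R) :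
  (exists z, P z) ->
  (forall z, P z -> Cmod z <= M) ->
  (forall z, ~ P z -> exists d, 0 < d /\ forall h, Cmod h < d -> ~ P (z + h)%C) ->
  (forall z, P z -> forall eps, 0 < eps -> exists d, 0 < d /\
     forall h, Cmod h < d -> v (z + h)%C < v z + eps) ->
  exists z0, P z0 /\ forall z, P z -> v z <= v z0.
Proof.
intros [z1 Hz1] HM Hcl Husc.
destruct (locally_bounded_on_compact P v M HM Hcl) as [B HB].
{ intros z Hz. destruct (Husc z Hz 1 Rlt_0_1) as [d [Hd H]].
  exists d, (v z + 1); split; trivial. intros h Hh _. left; auto. }
destruct (completeness (fun y => exists z, P z /\ y = v z)) as [S [HS1 HS2]].
- exists B. intros y [z [Hz ->]]. auto.
- exists (v z1), z1; auto.
- apply NNPP. intros Hno.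
  assert (HS : forall z, P z -> v z < S).
  { intros z Hz. destruct (Rle_lt_or_eq_dec (v z) S) as [|E]; trivial.
    - apply HS1. now exists z.
    - exfalso. apply Hno. exists z; split; trivial. intros z' Hz'. rewrite E. apply HS1. now exists z'. }
  destruct (locally_bounded_on_compact P (fun z => / (S - v z)) M HM Hcl) as [B' HB'].
  { intros z Hz. specialize (HS z Hz).
    destruct (Husc z Hz ((S - v z) / 2) ltac:(lra)) as [d [Hd H]].
    exists d, (/ ((S - v z) / 2)); split; trivial. intros h Hh _.
    specialize (H h Hh). apply Rinv_le_contravar; lra. }
  assert (HB'0 : 0 < B').
  { eapply Rlt_le_trans; [|apply (HB' z1 Hz1)]. apply Rinv_0_lt_compat. specialize (HS z1 Hz1). lra. }
  assert (Hub : S <= S - / B').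
  { apply HS2. intros y [z [Hz ->]]. specialize (HB' z Hz). specialize (HS z Hz).
    apply Rinv_le_contravar in HB'; [|apply Rinv_0_lt_compat; lra].
    rewrite Rinv_inv in HB'. lra. }
  apply Rinv_0_lt_compat in HB'0. lra.
Qed.

Definition rcont (u : C -> R) (z : C) : Prop :=
  forall eps, 0 < eps -> exists d, 0 < d /\ forall h, Cmod h < d -> Rabs (u (z + h)%C - u z) < eps.

Lemma rcont_mult (u v : C -> R) (z : C) :
  rcont u z -> rcont v z -> rcont (fun w => u w * v w) z.
Proof.
intros Hu Hv eps He.
assert (Pu := Rabs_pos (u z)). assert (Pv := Rabs_pos (v z)).
set (e := Rmin 1 (eps / (Rabs (u z) + Rabs (v z) + 2))).
assert (He0 : 0 < e) by (apply Rmin_glb_lt; [lra|apply Rdiv_lt_0_compat; lra]).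
assert (He1 : e <= 1) by apply Rmin_l.
assert (He2 : e * (Rabs (u z) + Rabs (v z) + 2) <= eps) by (apply Rle_div_r; [lra|apply Rmin_r]).
destruct (Hu e He0) as [d1 [Hd1 H1]]. destruct (Hv e He0) as [d2 [Hd2 H2]].
exists (Rmin d1 d2); split; [now apply Rmin_glb_lt|].
intros h Hh. apply Rmin_Rgt_l in Hh as [Hh1 Hh2].
specialize (H1 h Hh1). specialize (H2 h Hh2).
set (a := u (z + h)%C - u z) in *. set (b := v (z + h)%C - v z) in *.
replace (u (z + h)%C * v (z + h)%C - u z * v z) with (a * b + (a * v z + u z * b)) by (unfold a, b; ring).
eapply Rle_lt_trans; [apply Rabs_triang|].
eapply Rle_lt_trans; [apply Rplus_le_compat_l, Rabs_triang|].
rewrite !Rabs_mult.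
assert (Pa := Rabs_pos a). assert (Pb := Rabs_pos b).
assert (Rabs a * Rabs b <= e * 1) by (apply Rmult_le_compat; lra).
assert (Rabs a * Rabs (v z) <= e * Rabs (v z)) by (apply Rmult_le_compat_r; lra).
assert (Rabs (u z) * Rabs b <= Rabs (u z) * e) by (apply Rmult_le_compat_l; lra).
lra.
Qed.

Lemma rcont_real_comp (phi : R -> R) (u : C -> R) (z : C) :
  continuity_pt phi (u z) -> rcont u z -> rcont (fun w => phi (u w)) z.
Proof.
intros Hphi Hu eps He.
rewrite continuity_pt_locally in Hphi.
destruct (Hphi (mkposreal eps He)) as [d Hd].
destruct (Hu d (cond_pos d)) as [d' [Hd' H]].
exists d'; split; trivial. intros h Hh. apply Hd. now apply H.
Qed.

Lemma rcont_comp (u : C -> R) (f : C -> C) (z l : C) :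
  Cder f z l -> rcont u (f z) -> rcont (fun w => u (f w)) z.
Proof.
intros Hf Hu eps He. destruct (Hu eps He) as [d [Hd H]].
destruct (Cder_cont f z l Hf d Hd) as [d' [Hd' H']].
exists d'; split; trivial. intros h Hh. specialize (H _ (H' h Hh)).
now rewrite Cplus_sub in H.
Qed.

Lemma rcont_Cmod (z : C) : rcont Cmod z.
Proof.
intros eps He. exists eps; split; trivial. intros h Hh.
eapply Rle_lt_trans; [|exact Hh].
apply Rabs_le; split.
- assert (T := Cmod_triangle_rev z (z + h)).
  replace (z - (z + h))%C with (- h)%C in T by ring. rewrite Cmod_opp in T. lra.
- assert (T := Cmod_triangle_rev (z + h) z).
  replace (z + h - z)%C with h in T by ring. lra.
Qed.

Lemma has_laplacian_rcont (u : C -> R) (z : C) (k : R) : has_laplacian u z k -> rcont u z.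
Proof.
intros [a [b H]] eps He.
destruct (H 1 Rlt_0_1) as [d [Hd H']].
set (M := Cmod a + Cmod b + Rabs k + 1).
assert (Pa := Cmod_ge_0 a). assert (Pb := Cmod_ge_0 b). assert (Pk := Rabs_pos k).
exists (Rmin d (Rmin 1 (eps / M))); split.
{ repeat apply Rmin_glb_lt; try lra. apply Rdiv_lt_0_compat; unfold M; lra. }
intros h Hh. apply Rmin_Rgt_l in Hh as [Hh1 Hh]. apply Rmin_Rgt_l in Hh as [Hh2 Hh3].
specialize (H' h Hh1). assert (Ph := Cmod_ge_0 h).
apply Rgt_lt, Rlt_div_r in Hh3; [|unfold M; lra].
eapply Rle_lt_trans; [|exact Hh3].
set (A := Re (a * h + b * (h * h))%C) in *.
assert (HA : Rabs A <= Cmod a * Cmod h + Cmod b * (Cmod h * Cmod h)).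
{ eapply Rle_trans; [apply re_le_Cmod|]. eapply Rle_trans; [apply Cmod_triangle|].
  rewrite !Cmod_mult. lra. }
replace (u (z + h)%C - u z) with ((u (z + h)%C - u z - A - k * Cmod h ^ 2) + (A + k * Cmod h ^ 2)) by ring.
eapply Rle_trans; [apply Rabs_triang|].
eapply Rle_trans; [apply Rplus_le_compat_l, Rabs_triang|].
assert (P2 : 0 <= Cmod h ^ 2) by nra.
assert (P3 : Cmod h ^ 2 <= Cmod h) by nra.
rewrite (Rabs_mult k), (Rabs_pos_eq (Cmod h ^ 2)) by trivial.
assert (Rabs k * Cmod h ^ 2 <= Rabs k * Cmod h) by (apply Rmult_le_compat_l; lra).
assert (Cmod b * (Cmod h * Cmod h) <= Cmod b * Cmod h) by (apply Rmult_le_compat_l; lra).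
unfold M. lra.
Qed.

Lemma rcont_pos (u : C -> R) (z : C) : rcont u z -> 0 < u z ->
  exists d, 0 < d /\ forall h, Cmod h < d -> 0 < u (z + h)%C.
Proof.
intros Hu Hp. destruct (Hu (u z) Hp) as [d [Hd H]].
exists d; split; trivial. intros h Hh. specialize (H h Hh).
apply Rabs_lt_between in H. lra.
Qed.

(** The second-order jet of df at z0 needs a third derivative of f there, hence the last clause. *)
Lemma second_derivative (f df : C -> C) (z0 : C) (d : R) :
  0 < d -> (forall w, Cmod (w - z0)%C < d -> Cder f w (df w)) ->
  exists d2f : C -> C, (forall w, Cmod (w - z0)%C < d -> Cder df w (d2f w)) /\
    exists l, Cder d2f z0 l.
Proof.
intros Hd Hf.
exists (fun w => epsilon (inhabits (RtoC 0)) (Cder df w)).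
assert (H : forall w, Cmod (w - z0)%C < d -> Cder df w (epsilon (inhabits (RtoC 0)) (Cder df w))).
{ intros w Hw. apply epsilon_spec.
  apply (Cder_derivative f df w (d - Cmod (w - z0)%C)); [lra|].
  intros v Hv. apply Hf. assert (T := Cmod_dist_triangle v w z0). lra. }
split; trivial.
now apply (Cder_derivative df _ z0 d).
Qed.

(* The curvature comparison of Ahlfors' lemma: log |f'| is harmonic, so at a
   maximum of log (e^L(f) |f'| (r^2 - |z|^2)) the Laplacian of L o f is at most
   that of the hyperbolic density. *)
Lemma ahlfors_at_local_max (f df : C -> C) (L : C -> R) (z0 : C) (d r k : R) :
  0 < d -> (forall w, Cmod (w - z0)%C < d -> Cder f w (df w)) ->
  df z0 <> 0 -> Cmod z0 < r ->
  has_laplacian L (f z0) k -> exp (L (f z0)) ^ 2 <= k ->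
  (forall h, Cmod h < d ->
    exp (L (f (z0 + h)%C)) * Cmod (df (z0 + h)%C) * (r ^ 2 - Cmod (z0 + h)%C ^ 2)
    <= exp (L (f z0)) * Cmod (df z0) * (r ^ 2 - Cmod z0 ^ 2)) ->
  exp (L (f z0)) * Cmod (df z0) * (r ^ 2 - Cmod z0 ^ 2) <= r.
Proof.
intros Hd Hf Hdf Hz0 HL Hk Hmax.
destruct (second_derivative f df z0 d Hd Hf) as [d2f [Hd2f [l Hl]]].
assert (Hself : Cmod (z0 - z0)%C < d) by (replace (z0 - z0)%C with (RtoC 0) by ring; now rewrite Cmod_0).
assert (J1 := holo_jet_deriv f df z0 (d2f z0) d Hd Hf (Hd2f z0 Hself)).
assert (J2 := holo_jet_deriv df d2f z0 l d Hd Hd2f Hl).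
assert (L1 := has_laplacian_comp_holo L f z0 _ _ k HL J1).
(* log |f'| is t/2 at t = ln |f'|^2; the zero second derivative expresses its harmonicity. *)
assert (Hhalf : real_jet (fun t => t / 2) (ln (Cmod (df z0) ^ 2)) (1 / 2) 0).
{ intros eps He. exists 1; split; [lra|]. intros s _.
  match goal with |- Rabs ?e <= _ => replace e with 0 by field end.
  rewrite Rabs_R0. nra. }
assert (L2 := has_laplacian_comp_holo _ df z0 _ _ _ (has_laplacian_radial _ (df z0) _ _ Hdf Hhalf) J2).
assert (L3 := has_laplacian_ln_disk r z0 Hz0).
assert (LL := has_laplacian_plus _ _ _ _ _ (has_laplacian_plus _ _ _ _ _ L1 L2) L3).
cbv beta in LL.
assert (Hm0 := Cmod_ge_0 z0).
assert (Hp0 : 0 < Cmod (df z0)) by now apply Cmod_gt_0.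
destruct (rcont_pos (fun w => Cmod (df w)) z0) as [d1 [Hd1 H1]]; trivial.
{ apply (rcont_comp Cmod df z0 (d2f z0)); [now apply Hd2f|apply rcont_Cmod]. }
assert (Hlogform : forall w, 0 < Cmod (df w) -> Cmod w < r ->
  L (f w) + ln (Cmod (df w) ^ 2) / 2 + ln (r ^ 2 - Cmod w ^ 2)
   = ln (exp (L (f w)) * Cmod (df w) * (r ^ 2 - Cmod w ^ 2))).
{ intros w Hw1 Hw2. assert (T := Cmod_ge_0 w).
  assert (0 < exp (L (f w))) by apply exp_pos.
  rewrite ln_mult; [|now apply Rmult_lt_0_compat|nra]. rewrite ln_mult by trivial.
  rewrite ln_exp, ln_pow by trivial. simpl. field. }
assert (Hlap := laplacian_at_max _ z0 _ (Rmin d (Rmin d1 (r - Cmod z0))) LL).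
assert (Hle : k * Cmod (df z0) ^ 2 - (r / (r ^ 2 - Cmod z0 ^ 2)) ^ 2 <= 0).
{ replace (k * Cmod (df z0) ^ 2 - (r / (r ^ 2 - Cmod z0 ^ 2)) ^ 2)
   with (k * Cmod (df z0) ^ 2 + 0 / Cmod (df z0) ^ 2 * Cmod (d2f z0) ^ 2
     + - (r / (r ^ 2 - Cmod z0 ^ 2)) ^ 2) by (field; split; nra).
  apply Hlap; [repeat apply Rmin_glb_lt; lra|].
  intros h Hh. apply Rmin_Rgt_l in Hh as [Hh1 Hh]. apply Rmin_Rgt_l in Hh as [Hh2 Hh3].
  assert (Hzh : Cmod (z0 + h) < r) by (eapply Rle_lt_trans; [apply Cmod_triangle|lra]).
  specialize (H1 h Hh2).
  change (L (f (z0 + h)%C) + ln (Cmod (df (z0 + h)%C) ^ 2) / 2 + ln (r ^ 2 - Cmod (z0 + h)%C ^ 2)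
    <= L (f z0) + ln (Cmod (df z0) ^ 2) / 2 + ln (r ^ 2 - Cmod z0 ^ 2)).
  rewrite !Hlogform by trivial.
  apply ln_le; [|now apply Hmax].
  assert (T := Cmod_ge_0 (z0 + h)).
  apply Rmult_lt_0_compat; [apply Rmult_lt_0_compat; [apply exp_pos|trivial]|nra]. }
set (E := exp (L (f z0))) in *. set (D := Cmod (df z0)) in *. set (q := r ^ 2 - Cmod z0 ^ 2) in *.
assert (HE : 0 < E) by apply exp_pos.
assert (Hq : 0 < q) by (unfold q; nra).
assert (H2 : (E * D) ^ 2 <= (r / q) ^ 2).
{ rewrite Rpow_mult_distr. apply Rle_trans with (k * D ^ 2); [|lra].
  apply Rmult_le_compat_r; [nra|trivial]. }
assert (H3 : E * D <= r / q).
{ apply Rsqr_incr_0_var; [now rewrite !Rsqr_pow2|].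
  apply Rmult_le_pos; [lra|left; now apply Rinv_0_lt_compat]. }
now apply Rle_div_r.
Qed.

(** The maximum is taken over the compact set |z| <= r with f z in the closed set Q. Where f z0 is
    interior to Q, all nearby points compete and [ahlfors_at_local_max] applies; elsewhere the bound
    is a hypothesis. Taking r < 1 keeps the compact disk inside the domain. *)
Lemma ahlfors_schwarz (f df : C -> C) (Q : C -> Prop) (L kappa : C -> R) (r : R) :
  0 < r < 1 ->
  (forall z, Cmod z < 1 -> Cder f z (df z)) ->
  (forall w, ~ Q w -> exists d, 0 < d /\ forall k, Cmod k < d -> ~ Q (w + k)%C) ->
  (forall z, Cmod z < 1 -> Q (f z) ->
     has_laplacian L (f z) (kappa (f z)) /\ exp (L (f z)) ^ 2 <= kappa (f z)) ->
  (forall z, Cmod z < r -> Q (f z) ->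
     (exists d, 0 < d /\ forall k, Cmod k < d -> Q (f z + k)%C) \/
     exp (L (f z)) * Cmod (df z) * (r ^ 2 - Cmod z ^ 2) <= r) ->
  forall z, Cmod z <= r -> Q (f z) ->
  exp (L (f z)) * Cmod (df z) * (r ^ 2 - Cmod z ^ 2) <= r.
Proof.
intros Hr Hf HQ HL Hbd z Hz HQz.
assert (Hddf : forall w, Cmod w < 1 -> exists l, Cder df w l).
{ intros w Hw. apply (Cder_derivative f df w (1 - Cmod w)); [lra|].
  intros v Hv. apply Hf. assert (T := Cmod_triangle_rev v w). lra. }
destruct (max_on_compact (fun w => Cmod w <= r /\ Q (f w))
  (fun w => exp (L (f w)) * Cmod (df w) * (r ^ 2 - Cmod w ^ 2)) r) as [z0 [[Hz0 HQz0] Hmax]].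
- now exists z.
- now intros w [Hw _].
- intros w Hw. destruct (Rle_lt_dec (Cmod w) r) as [Hwr|Hwr].
  + assert (HnQ : ~ Q (f w)) by (intros T; apply Hw; auto).
    destruct (HQ _ HnQ) as [d [Hd H]].
    destruct (Cder_cont f w _ (Hf w ltac:(lra)) d Hd) as [d' [Hd' H']].
    exists d'; split; trivial. intros h Hh [_ Hc].
    specialize (H _ (H' h Hh)). rewrite Cplus_sub in H. auto.
  + exists (Cmod w - r); split; [lra|]. intros h Hh [Hc _].
    assert (T := Cmod_triangle_rev w (- h)). rewrite Cmod_opp in T.
    replace (w - - h)%C with (w + h)%C in T by ring. lra.
- intros w [Hw HQw].
  assert (Hw1 : Cmod w < 1) by lra.
  assert (Hc : rcont (fun w => exp (L (f w)) * Cmod (df w) * (r ^ 2 - Cmod w ^ 2)) w).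
  { destruct (Hddf w Hw1) as [l Hl].
    apply (rcont_mult (fun w => exp (L (f w)) * Cmod (df w)) (fun w => r ^ 2 - Cmod w ^ 2)).
    - apply (rcont_mult (fun w => exp (L (f w))) (fun w => Cmod (df w))).
      + apply (rcont_comp (fun w => exp (L w)) f w (df w)); [now apply Hf|].
        apply rcont_real_comp; [apply derivable_continuous_pt, derivable_pt_exp|].
        eapply has_laplacian_rcont. now apply HL.
      + apply (rcont_comp Cmod df w l); trivial. apply rcont_Cmod.
    - apply (rcont_real_comp (fun t => r ^ 2 - t ^ 2) Cmod); [|apply rcont_Cmod].
      apply derivable_continuous_pt. reg. }
  intros eps He. destruct (Hc eps He) as [d [Hd H]].
  exists d; split; trivial. intros h Hh. specialize (H h Hh).
  apply Rabs_lt_between in H. simpl in *. lra.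
- eapply Rle_trans; [apply (Hmax z); auto|].
  (* A positive maximum excludes both a zero of df, where the logarithm breaks down, and the circle
     |z| = r. *)
  destruct (Rle_lt_dec (exp (L (f z0)) * Cmod (df z0) * (r ^ 2 - Cmod z0 ^ 2)) 0) as [|Hpos]; [lra|].
  assert (Hdf : df z0 <> 0).
  { intros E. rewrite E, Cmod_0 in Hpos. lra. }
  assert (Hz0r : Cmod z0 < r).
  { destruct Hz0 as [|E]; trivial. rewrite E in Hpos. lra. }
  destruct (Hbd z0 Hz0r HQz0) as [[d [Hd HQd]]|]; trivial.
  destruct (Cder_cont f z0 _ (Hf z0 ltac:(lra)) d Hd) as [d' [Hd' H']].
  destruct (HL z0 ltac:(lra) HQz0) as [HL1 HL2].
  assert (Hdd : 0 < Rmin d' (r - Cmod z0)) by (apply Rmin_glb_lt; lra).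
  assert (T1 := Rmin_l d' (r - Cmod z0)). assert (T2 := Rmin_r d' (r - Cmod z0)).
  apply (ahlfors_at_local_max f df L z0 (Rmin d' (r - Cmod z0)) r (kappa (f z0))); trivial.
  + intros w Hw. apply Hf. assert (T := Cmod_triangle_rev w z0). lra.
  + intros h Hh. apply Hmax. split.
    * eapply Rle_trans; [apply Cmod_triangle|]. lra.
    * specialize (HQd _ (H' h ltac:(lra))). now rewrite Cplus_sub in HQd.
Qed.

(** * Two metrics of negative curvature *)

Lemma has_laplacian_shift (u : C -> R) (c z : C) (k : R) :
  has_laplacian u (z - c)%C k -> has_laplacian (fun w => u (w - c)%C) z k.
Proof.
intros H. replace k with (k * Cmod 1 ^ 2) by (rewrite Cmod_1; ring).
apply (has_laplacian_comp_holo u (fun w => w - c)%C z 1 0 k H).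
intros eps He. exists 1; split; [lra|]. intros h _.
replace (z + h - c - (z - c) - (1 * h + 0 * (h * h)))%C with (RtoC 0) by ring.
rewrite Cmod_0. assert (T := Cmod_ge_0 h). nra.
Qed.

Lemma has_laplacian_const (c : R) (z : C) : has_laplacian (fun _ => c) z 0.
Proof.
exists 0, 0. intros eps He. exists 1; split; [lra|]. intros h _.
replace (c - c - Re (0 * h + 0 * (h * h))%C - 0 * Cmod h ^ 2) with 0
  by (unfold Re, Cplus, Cmult, RtoC; simpl; ring).
rewrite Rabs_R0. assert (T := Cmod_ge_0 h). nra.
Qed.

(* Logarithm of (1 + |w|^(1/2))^(1/4) / |w|^(3/4), as a function of t = ln |w|^2. *)
Definition robinson (t : R) : R := ln (1 + exp (t / 4)) / 4 - 3 / 8 * t.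

Lemma robinson_jet (t : R) :
  exists p, real_jet robinson t p (exp (t / 4) / (64 * (1 + exp (t / 4)) ^ 2)).
Proof.
eexists. apply (real_jet_deriv robinson
  (fun s => exp (s / 4) / (16 * (1 + exp (s / 4))) - 3 / 8) _ _ 1); [lra| |].
- intros s _. assert (Hp := exp_pos (s / 4)). unfold robinson.
  apply is_derive_Reals. auto_derive; [lra|]. unfold Rdiv in *. field; lra.
- assert (Hp := exp_pos (t / 4)).
  apply is_derive_Reals. auto_derive; [lra|]. unfold Rdiv in *. field; lra.
Qed.

(** With p = exp (t/4), which is |w|^(1/2) at t = ln |w|^2, the number a is the square root of 1 +
    p. Naming it keeps the curvature estimate rational in a and p. *)
Lemma exp_robinson_sq (t : R) :
  exists a, 0 < a /\ a ^ 2 = 1 + exp (t / 4) /\ exp (robinson t) ^ 2 = a / exp (t / 4) ^ 3.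
Proof.
assert (Hp : 0 < exp (t / 4)) by apply exp_pos.
exists (exp (ln (1 + exp (t / 4)) / 2)); split; [apply exp_pos|split].
- simpl. rewrite Rmult_1_r, <- exp_plus.
  replace (ln (1 + exp (t / 4)) / 2 + ln (1 + exp (t / 4)) / 2) with (ln (1 + exp (t / 4))) by field.
  apply exp_ln; lra.
- apply Rmult_eq_reg_r with (exp (t / 4) ^ 3); [|apply pow_nonzero; lra].
  replace (exp (ln (1 + exp (t / 4)) / 2) / exp (t / 4) ^ 3 * exp (t / 4) ^ 3)
    with (exp (ln (1 + exp (t / 4)) / 2)) by (field; lra).
  simpl. rewrite !Rmult_1_r, <- !exp_plus. f_equal. unfold robinson. field.
Qed.

Lemma ln_nonpos (x : R) : 0 < x <= 1 -> ln x <= 0.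
Proof. intros Hx. rewrite <- ln_1. now apply ln_le. Qed.

(* The factor 1/32 makes the curvature of the metric at most -4. *)
Definition log_metric (w : C) : R :=
  robinson (ln (Cmod w ^ 2)) + robinson (ln (Cmod (w - 1)%C ^ 2)) + - ln 32.

Definition metric_laplacian (w : C) : R :=
  let p := exp (ln (Cmod w ^ 2) / 4) in let q := exp (ln (Cmod (w - 1)%C ^ 2) / 4) in
  p / (64 * (1 + p) ^ 2) / Cmod w ^ 2 + q / (64 * (1 + q) ^ 2) / Cmod (w - 1)%C ^ 2.

Lemma has_laplacian_log_metric (w : C) : w <> 0 -> w <> 1 ->
  has_laplacian log_metric w (metric_laplacian w).
Proof.
intros H0 H1.
assert (H1' : (w - 1)%C <> 0).
{ intros E. apply H1. replace w with ((w - 1) + 1)%C by ring. rewrite E. ring. }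
destruct (robinson_jet (ln (Cmod w ^ 2))) as [p Hp].
destruct (robinson_jet (ln (Cmod (w - 1)%C ^ 2))) as [q Hq].
assert (L1 := has_laplacian_radial _ _ _ _ H0 Hp).
assert (L2 := has_laplacian_shift _ _ _ _ (has_laplacian_radial _ _ _ _ H1' Hq)).
assert (L := has_laplacian_plus _ _ _ _ _ (has_laplacian_plus _ _ _ _ _ L1 L2)
   (has_laplacian_const (- ln 32) w)).
rewrite Rplus_0_r in L. exact L.
Qed.

(** With p^2 and q^2 the distances to the two punctures, the Laplacian term of the nearer puncture
    alone dominates. From p >= 7/10 follows 1 + p <= 5/2 p, and (5/2)^3 <= 16 = 1024 / 64, where
    1/1024 is the square of the factor 1/32. *)
Lemma robinson_curvature_aux (p q a b : R) :
  0 < p -> 0 < q -> 0 < a -> 0 < b -> a ^ 2 = 1 + p -> b ^ 2 = 1 + q -> q <= p ->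
  1 / 2 <= p ^ 2 ->
  a / p ^ 3 * (b / q ^ 3) * (1 / 1024) <= q / (64 * (1 + q) ^ 2) / q ^ 4.
Proof.
intros Hp Hq Ha Hb Ea Eb Hqp Hp2.
assert (Hp7 : 7 / 10 <= p) by nra.
assert (Hab : a * b <= 1 + p) by nra.
assert (Hab0 : 0 < a * b) by nra.
assert (H1 : 1 + p <= 25 / 10 * p) by lra.
assert (H2 : (1 + q) ^ 2 <= (25 / 10 * p) ^ 2) by (apply pow_incr; lra).
assert (H3 : a * b * (1 + q) ^ 2 <= 25 / 10 * p * (25 / 10 * p) ^ 2).
{ apply Rmult_le_compat; try lra. nra. }
assert (Hp3 : 0 < p ^ 3) by (now apply pow_lt).
assert (Hq3 : 0 < q ^ 3) by (now apply pow_lt).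
assert (H4 : a * b * (1 + q) ^ 2 <= 16 * p ^ 3) by nra.
assert (Hq1 : 0 < (1 + q) ^ 2) by nra.
replace (a / p ^ 3 * (b / q ^ 3) * (1 / 1024))
  with (a * b * (1 + q) ^ 2 * (/ (1024 * p ^ 3 * q ^ 3 * (1 + q) ^ 2))) by (field; lra).
replace (q / (64 * (1 + q) ^ 2) / q ^ 4)
  with (16 * p ^ 3 * (/ (1024 * p ^ 3 * q ^ 3 * (1 + q) ^ 2))) by (field; lra).
apply Rmult_le_compat_r; [|trivial].
left. apply Rinv_0_lt_compat. repeat apply Rmult_lt_0_compat; lra.
Qed.

Lemma quarter_power (s : R) : 0 < s ->
  exp (ln (s ^ 2) / 4) ^ 4 = s ^ 2 /\ exp (ln (s ^ 2) / 4) ^ 2 = s.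
Proof.
intros Hs. assert (Hs2 : 0 < s ^ 2) by now apply pow_lt.
assert (E : exp (ln (s ^ 2) / 4) ^ 2 = s).
{ rewrite ln_pow by trivial. simpl INR. simpl pow. rewrite Rmult_1_r, <- exp_plus.
  replace ((1 + 1) * ln s / 4 + (1 + 1) * ln s / 4) with (ln s) by field. now apply exp_ln. }
split; trivial. replace 4%nat with (2 * 2)%nat by reflexivity. now rewrite pow_mult, E.
Qed.

(** Since |w| + |w - 1| >= 1, the farther puncture is at distance at least 1/2;
    [robinson_curvature_aux] then applies up to exchanging the punctures, and the other Laplacian
    term is dropped as positive. *)
Lemma log_metric_curvature (w : C) : w <> 0 -> w <> 1 ->
  exp (log_metric w) ^ 2 <= metric_laplacian w.
Proof.
intros H0 H1.
assert (H1' : (w - 1)%C <> 0).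
{ intros E. apply H1. replace w with ((w - 1) + 1)%C by ring. rewrite E. ring. }
assert (M0 : 0 < Cmod w) by now apply Cmod_gt_0.
assert (M1 : 0 < Cmod (w - 1)%C) by now apply Cmod_gt_0.
assert (Hsum : 1 <= Cmod w + Cmod (w - 1)%C).
{ rewrite <- Cmod_1 at 1. replace (RtoC 1) with (w - (w - 1))%C at 1 by ring.
  unfold Cminus at 1. eapply Rle_trans; [apply Cmod_triangle|]. rewrite Cmod_opp. lra. }
unfold log_metric, metric_laplacian.
destruct (quarter_power _ M0) as [P4 P2]. destruct (quarter_power _ M1) as [Q4 Q2].
destruct (exp_robinson_sq (ln (Cmod w ^ 2))) as [a [Ha [Ea Fa]]].
destruct (exp_robinson_sq (ln (Cmod (w - 1)%C ^ 2))) as [b [Hb [Eb Fb]]].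
rewrite !exp_plus, !Rpow_mult_distr, Fa, Fb.
rewrite exp_Ropp, exp_ln by lra.
replace ((/ 32) ^ 2) with (1 / 1024) by field.
assert (Hp : 0 < exp (ln (Cmod w ^ 2) / 4)) by apply exp_pos.
assert (Hq : 0 < exp (ln (Cmod (w - 1)%C ^ 2) / 4)) by apply exp_pos.
set (p := exp (ln (Cmod w ^ 2) / 4)) in *.
set (q := exp (ln (Cmod (w - 1)%C ^ 2) / 4)) in *.
rewrite <- P4, <- Q4.
assert (Pp : forall x, 0 < x -> 0 < x / (64 * (1 + x) ^ 2) / x ^ 4).
{ intros x Hx. apply Rdiv_lt_0_compat; [apply Rdiv_lt_0_compat; [trivial|]|now apply pow_lt].
  assert (0 < (1 + x) ^ 2) by (apply pow_lt; lra). lra. }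
destruct (Rle_lt_dec q p) as [Hqp|Hqp].
- assert (T := robinson_curvature_aux p q a b Hp Hq Ha Hb Ea Eb Hqp).
  assert (T' := Pp p Hp). assert (q ^ 2 <= p ^ 2) by (apply pow_incr; lra). lra.
- assert (T := robinson_curvature_aux q p b a Hq Hp Hb Ha Eb Ea ltac:(lra)).
  assert (T' := Pp q Hq). assert (p ^ 2 <= q ^ 2) by (apply pow_incr; lra).
  replace (a / p ^ 3 * (b / q ^ 3)) with (b / q ^ 3 * (a / p ^ 3)) by ring. lra.
Qed.

Lemma robinson_lower (t : R) : - (3 / 8 * t) <= robinson t.
Proof.
unfold robinson. assert (Hp : 0 < exp (t / 4)) by apply exp_pos.
assert (0 <= ln (1 + exp (t / 4))) by (rewrite <- ln_1; apply ln_le; lra). lra.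
Qed.

(** Each factor of the density is at least (|w| + 1)^(-3/4). The resulting exponent 3/2 is relaxed
    to 2 to avoid fractional powers. *)
Lemma log_metric_lower (w : C) : w <> 0 -> w <> 1 ->
  / (32 * (Cmod w + 1) ^ 2) <= exp (log_metric w).
Proof.
intros H0 H1.
assert (H1' : (w - 1)%C <> 0).
{ intros E. apply H1. replace w with ((w - 1) + 1)%C by ring. rewrite E. ring. }
assert (M0 : 0 < Cmod w) by now apply Cmod_gt_0.
assert (M1 : 0 < Cmod (w - 1)%C) by now apply Cmod_gt_0.
assert (Hm : Cmod (w - 1)%C <= Cmod w + 1).
{ unfold Cminus; eapply Rle_trans; [apply Cmod_triangle|]. rewrite Cmod_opp, Cmod_1. lra. }
assert (Hlog : forall s, 0 < s <= Cmod w + 1 -> ln (s ^ 2) <= 2 * ln (Cmod w + 1)).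
{ intros s Hs. rewrite ln_pow by lra. simpl INR.
  assert (ln s <= ln (Cmod w + 1)) by (apply ln_le; lra). lra. }
assert (G1 := Hlog (Cmod w) ltac:(lra)). assert (G2 := Hlog (Cmod (w - 1)%C) ltac:(lra)).
assert (L1 := robinson_lower (ln (Cmod w ^ 2))).
assert (L2 := robinson_lower (ln (Cmod (w - 1)%C ^ 2))).
assert (G3 : 0 <= ln (Cmod w + 1)) by (rewrite <- ln_1; apply ln_le; lra).
assert (Hsq : 0 < (Cmod w + 1) ^ 2) by (apply pow_lt; lra).
rewrite <- (exp_ln (/ (32 * (Cmod w + 1) ^ 2))) by (apply Rinv_0_lt_compat; lra).
rewrite ln_Rinv, ln_mult, ln_pow by lra. simpl INR.
assert (Hle : - (ln 32 + (1 + 1) * ln (Cmod w + 1)) <= log_metric w) by (unfold log_metric; lra).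
destruct Hle as [Hlt|E]; [left; now apply exp_increasing|rewrite E; apply Rle_refl].
Qed.

(** * Landau theorems for functions omitting 0 and 1 *)

(** Stated at every z and with the factor r^2 - |z|^2, because [landau_sharp] needs it in this form
    wherever |f z| = 1. *)
Lemma landau_crude_disk (f df : C -> C) (r : R) :
  0 < r < 1 -> (forall z, Cmod z < 1 -> Cder f z (df z)) ->
  (forall z, Cmod z < 1 -> f z <> 0 /\ f z <> 1) ->
  forall z, Cmod z < r ->
  Cmod (df z) * (r ^ 2 - Cmod z ^ 2) <= 32 * (Cmod (f z) + 1) ^ 2 * r.
Proof.
intros Hr Hf Hav z Hz.
destruct (Hav z ltac:(lra)) as [Hz0 Hz1].
assert (B := ahlfors_schwarz f df (fun _ => True) log_metric metric_laplacian r Hr Hf).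
assert (B' : exp (log_metric (f z)) * Cmod (df z) * (r ^ 2 - Cmod z ^ 2) <= r).
{ apply B; trivial; [tauto| | |lra].
  - intros w Hw _. destruct (Hav w Hw).
    split; [now apply has_laplacian_log_metric|now apply log_metric_curvature].
  - intros w _ _. left. exists 1; split; [lra|trivial]. }
assert (HL := log_metric_lower (f z) Hz0 Hz1).
assert (Hm := Cmod_ge_0 (f z)). assert (Hd := Cmod_ge_0 (df z)). assert (Hz' := Cmod_ge_0 z).
assert (Hsq : 0 < (Cmod (f z) + 1) ^ 2) by (apply pow_lt; lra).
set (N := 32 * (Cmod (f z) + 1) ^ 2) in *.
assert (HN : 0 < N) by (unfold N; lra).
set (X := Cmod (df z) * (r ^ 2 - Cmod z ^ 2)).
assert (HX : 0 <= X) by (unfold X; apply Rmult_le_pos; [trivial|nra]).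
assert (Hx : / N * X <= r).
{ eapply Rle_trans; [|exact B']. rewrite Rmult_assoc. now apply Rmult_le_compat_r. }
apply (Rmult_le_compat_l N) in Hx; [|lra].
rewrite <- Rmult_assoc, Rinv_r, Rmult_1_l in Hx by lra. exact Hx.
Qed.

Lemma le_of_le_scaled (x y : R) : 0 <= x -> (forall r, 0 < r < 1 -> x * r <= y) -> x <= y.
Proof.
intros Hx H. apply le_epsilon. intros eps He.
assert (Hr : 0 < 1 - Rmin (1 / 2) (eps / (x + 1)) < 1).
{ assert (0 < Rmin (1 / 2) (eps / (x + 1))) by (apply Rmin_glb_lt; [lra|apply Rdiv_lt_0_compat; lra]).
  assert (T := Rmin_l (1 / 2) (eps / (x + 1))). lra. }
specialize (H _ Hr).
assert (T := Rmin_r (1 / 2) (eps / (x + 1))).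
apply Rle_div_r in T; [|lra].
set (m := Rmin _ _) in *. lra.
Qed.

Lemma landau_crude (f df : C -> C) :
  (forall z, Cmod z < 1 -> Cder f z (df z)) ->
  (forall z, Cmod z < 1 -> f z <> 0 /\ f z <> 1) ->
  Cmod (df 0) <= 32 * (Cmod (f 0) + 1) ^ 2.
Proof.
intros Hf Hav. apply le_of_le_scaled; [apply Cmod_ge_0|].
intros r Hr. assert (B := landau_crude_disk f df r Hr Hf Hav 0).
rewrite Cmod_0 in B. specialize (B ltac:(lra)).
apply Rmult_le_reg_r with r; [lra|].
eapply Rle_trans; [|exact B]. apply Req_le; ring.
Qed.

(* With t = ln |w|^2 this is the logarithm of 1 / (2 |w| (A + ln (1/|w|))),
   the hyperbolic density of the punctured disk 0 < |w| < e^A, for A = 64. *)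
Definition punctured (t : R) : R := - t / 2 - ln (128 - t).

Lemma punctured_jet (t : R) : t <= 0 -> exists p, real_jet punctured t p (/ (128 - t) ^ 2).
Proof.
intros Ht. eexists.
apply (real_jet_deriv punctured (fun s => / (128 - s) - / 2) _ _ 1); [lra| |].
- intros s Hs. apply Rabs_lt_between in Hs. unfold punctured.
  apply is_derive_Reals. auto_derive; [lra|]. field; lra.
- apply is_derive_Reals. auto_derive; [lra|]. field; lra.
Qed.

Lemma exp_punctured (w : C) : w <> 0 -> Cmod w <= 1 ->
  exp (punctured (ln (Cmod w ^ 2))) = / (Cmod w * (128 + 2 * ln (/ Cmod w))).
Proof.
intros H0 H1. assert (M0 : 0 < Cmod w) by now apply Cmod_gt_0.
assert (Hl : ln (Cmod w) <= 0) by (apply ln_nonpos; lra).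
unfold punctured. rewrite ln_pow by trivial. simpl INR.
rewrite ln_Rinv by trivial.
replace (- ((1 + 1) * ln (Cmod w)) / 2 - ln (128 - (1 + 1) * ln (Cmod w)))
  with (- (ln (Cmod w) + ln (128 + 2 * - ln (Cmod w)))).
- rewrite exp_Ropp, exp_plus, !exp_ln by lra. reflexivity.
- replace (128 + 2 * - ln (Cmod w)) with (128 - (1 + 1) * ln (Cmod w)) by ring. field.
Qed.

Lemma landau_sharp (f df : C -> C) :
  (forall z, Cmod z < 1 -> Cder f z (df z)) ->
  (forall z, Cmod z < 1 -> f z <> 0 /\ f z <> 1) ->
  Cmod (f 0) <= 1 ->
  Cmod (df 0) <= Cmod (f 0) * (128 + 2 * ln (/ Cmod (f 0))).
Proof.
intros Hf Hav Ha.
assert (Hf0 : f 0 <> 0) by (apply Hav; rewrite Cmod_0; lra).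
assert (M0 : 0 < Cmod (f 0)) by now apply Cmod_gt_0.
apply le_of_le_scaled; [apply Cmod_ge_0|]. intros r Hr.
assert (Hln : forall w : C, w <> 0 -> Cmod w <= 1 -> ln (Cmod w ^ 2) <= 0).
{ intros w Hw Hw1. assert (0 < Cmod w) by now apply Cmod_gt_0.
  apply ln_nonpos; split; [now apply pow_lt|nra]. }
assert (B : exp (punctured (ln (Cmod (f 0) ^ 2))) * Cmod (df 0) * (r ^ 2 - Cmod 0 ^ 2) <= r).
{ apply (ahlfors_schwarz f df (fun w => Cmod w <= 1) (fun w => punctured (ln (Cmod w ^ 2)))
   (fun w => / (128 - ln (Cmod w ^ 2)) ^ 2 / Cmod w ^ 2) r Hr Hf); trivial.
  - intros w Hw. exists (Cmod w - 1); split; [lra|]. intros h Hh Hc.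
    assert (T := Cmod_triangle_rev w (- h)). rewrite Cmod_opp in T.
    replace (w - - h)%C with (w + h)%C in T by ring. lra.
  - intros z Hz Hfz. destruct (Hav z Hz) as [Hfz0 _].
    specialize (Hln _ Hfz0 Hfz).
    destruct (punctured_jet _ Hln) as [p Hp].
    split; [exact (has_laplacian_radial _ _ _ _ Hfz0 Hp)|].
    assert (Mz : 0 < Cmod (f z)) by now apply Cmod_gt_0.
    rewrite exp_punctured, ln_pow, ln_Rinv in * by trivial. simpl INR in *.
    (* The punctured-disk density has curvature exactly -4, so the curvature inequality is an
       equality. *)
    apply Req_le. field. lra.
  - intros z Hz Hfz. destruct (Hav z ltac:(lra)) as [Hfz0 _].
    destruct (Rle_lt_or_eq_dec _ _ Hfz) as [Hlt|E].
    + left. exists (1 - Cmod (f z)); split; [lra|]. intros k Hk.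
      eapply Rle_trans; [apply Cmod_triangle|]. lra.
    (* On |f z| = 1 the crude constant is 32 (1 + 1)^2 = 128 and the density is 1/128. This match is
       the origin of 128 in [punctured]. *)
    + right. assert (Bc := landau_crude_disk f df r Hr Hf Hav z Hz).
      rewrite exp_punctured by trivial. rewrite E in *.
      rewrite Rinv_1, ln_1.
      replace (/ (1 * (128 + 2 * 0))) with (/ 128) by field. lra.
  - rewrite Cmod_0; lra. }
rewrite exp_punctured in B by trivial.
assert (Hl : 0 <= ln (/ Cmod (f 0))).
{ rewrite ln_Rinv by trivial.
  assert (ln (Cmod (f 0)) <= 0) by (apply ln_nonpos; lra). lra. }
rewrite Cmod_0 in B.
set (N := Cmod (f 0) * (128 + 2 * ln (/ Cmod (f 0)))) in *.
assert (HN : 0 < N) by (unfold N; apply Rmult_lt_0_compat; lra).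
apply Rmult_le_reg_l with (/ N); [now apply Rinv_0_lt_compat|].
rewrite Rinv_l by lra.
apply Rmult_le_reg_r with r; [lra|].
eapply Rle_trans; [|rewrite Rmult_1_l; exact B]. apply Req_le; ring.
Qed.

(** * Holomorphic motions *)

Lemma Cmod_lt_ball (z w : C) (d : posreal) :
  Cmod (w - z)%C < d -> @ball C_UniformSpace z d w.
Proof.
intros H. split.
- eapply Rle_lt_trans; [apply (re_le_Cmod (w - z)%C)|exact H].
- eapply Rle_lt_trans; [apply (im_le_Cmod (w - z)%C)|exact H].
Qed.

(** Balls of the product uniform structure are squares, hence the factor 2. *)
Lemma ball_Cmod_lt (z w : C) (d : posreal) :
  @ball C_UniformSpace z d w -> Cmod (w - z)%C < 2 * d.
Proof.
intros [H1 H2]. eapply Rle_lt_trans; [apply Cmod_le_abs_sum|].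
change (Rabs (Re w - Re z) < d) in H1. change (Rabs (Im w - Im z) < d) in H2.
change (Rabs (Re w - Re z) + Rabs (Im w - Im z) < 2 * d). lra.
Qed.

Lemma Cder_affine (F : C -> sphere) (c : C) :
  F c <> infty -> sphere_differentiable F c ->
  exists l, Cder (fun u => affine (F u)) c l.
Proof.
intros Hc [chart [Hchart [g [[d Hg] [l Hl]]]]].
apply Cder_is_derive in Hl.
assert (Hg' : forall h, Cmod h < d -> F (c + h)%C = chart (g (c + h)%C)).
{ intros h Hh. apply Hg, Cmod_lt_ball. now replace (c + h - c)%C with h by ring. }
assert (Hg0 : F c = chart (g c)).
{ replace c with (c + 0)%C by ring. apply Hg'. rewrite Cmod_0. apply cond_pos. }
destruct Hchart as [-> | ->].
- exists l. apply (Cder_ext_loc g); trivial.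
  exists d; split; [apply cond_pos|]. intros h Hh. now rewrite Hg'.
- assert (Hgc : g c <> 0).
  { intros E. apply Hc. rewrite Hg0. unfold chart_infty. now destruct (Ceq_dec (g c) 0). }
  eexists. apply (Cder_ext_loc (fun u => / g u)%C).
  + exists d; split; [apply cond_pos|]. intros h Hh. rewrite Hg' by trivial.
    (* Where g vanishes, [affine infty] and [Cinv 0] are both 0, so the two functions agree without
       shrinking the neighbourhood. *)
    unfold chart_infty. destruct (Ceq_dec (g (c + h)%C) 0) as [E|E]; simpl; [|reflexivity].
    rewrite E. unfold Cinv, RtoC; simpl. f_equal; unfold Rdiv; ring.
  + apply (Cder_comp Cinv g); [now apply Cder_inv|exact Hl].
Qed.

Lemma Cder_of_filterlim (F : C -> C) (v : C) :
  filterlim (fun c : C => ((F c - F 0) / c)%C) (locally' (RtoC 0)) (locally v) ->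
  Cder F 0 v.
Proof.
intros H eps He.
assert (He2 : 0 < eps / 2) by lra.
destruct (H (fun w => @ball C_UniformSpace v (mkposreal _ He2) w)) as [d Hd].
{ now exists (mkposreal _ He2). }
exists d; split; [apply cond_pos|]. intros h Hh.
destruct (Ceq_dec h 0) as [->|Hh0].
{ replace (F (0 + 0) - F 0 - v * 0)%C with (F (0 + 0) - F 0)%C by ring.
  replace (0 + 0)%C with (RtoC 0) by ring.
  replace (F 0 - F 0)%C with (RtoC 0) by ring. rewrite Cmod_0; lra. }
assert (Hb : @ball C_UniformSpace (RtoC 0) d h).
{ apply Cmod_lt_ball. now replace (h - 0)%C with h by ring. }
specialize (Hd h Hb Hh0). apply ball_Cmod_lt in Hd. simpl in Hd.
replace (0 + h)%C with h by ring.
replace (F h - F 0 - v * h)%C with (((F h - F 0) / h - v) * h)%C by (field; trivial).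
rewrite Cmod_mult. apply Rmult_le_compat_r; [apply Cmod_ge_0|lra].
Qed.

(** The point precedes the parameter, so that a partial application is a holomorphic function of
    c. *)
Definition motion_coord (h : C -> sphere -> sphere) (z c : C) : C := affine (h c (Some z)).

Lemma motion_affine_coordinate (h : C -> sphere -> sphere) (V : C -> C) :
  holomorphic_motion (fun _ : sphere => True) h -> normalized h -> tangent_vector h V ->
  let F := motion_coord h in
  (forall z, F z 0 = z) /\
  (forall z, Cder (F z) 0 (V z)) /\
  (forall z c, Cmod c < 1 -> exists l, Cder (F z) c l) /\
  (forall c z w, Cmod c < 1 -> F z c = F w c -> z = w) /\
  (forall c, Cmod c < 1 -> F 0 c = 0 /\ F 1 c = 1).
Proof.
intros [H0 [Hinj Hhol]] Hnorm HV F.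
(* Infinity is fixed and h c is injective, so finite points stay finite. *)
assert (Hfin : forall z c, Cmod c < 1 -> h c (Some z) = Some (F z c)).
{ intros z c Hc. unfold F, motion_coord. destruct (h c (Some z)) as [w|] eqn:E; [reflexivity|].
  destruct (Hnorm c Hc) as [_ [_ Hinf]].
  assert (T := Hinj c Hc (Some z) infty I I). rewrite E, Hinf in T. now specialize (T eq_refl). }
assert (HF0 : forall z, F z 0 = z) by (intros z; unfold F, motion_coord; now rewrite H0).
repeat split; trivial.
- intros z. apply Cder_of_filterlim. rewrite HF0. apply HV.
- intros z c Hc. apply (Cder_affine (fun c => h c (Some z))); [|now apply Hhol].
  now rewrite (Hfin z c Hc).
- intros c z w Hc E. assert (T := Hinj c Hc (Some z) (Some w) I I).
  rewrite !Hfin, E in T by trivial. now injection (T eq_refl).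
- unfold F, motion_coord. destruct (Hnorm c H) as [E _]. now rewrite E.
- unfold F, motion_coord. destruct (Hnorm c H) as [_ [E _]]. now rewrite E.
Qed.

Lemma derivative_function (f : C -> C) (v : C) :
  (forall z, Cmod z < 1 -> exists l, Cder f z l) -> Cder f 0 v ->
  exists df : C -> C, (forall z, Cmod z < 1 -> Cder f z (df z)) /\ df 0 = v.
Proof.
intros Hf Hv. exists (fun z => epsilon (inhabits (RtoC 0)) (Cder f z)).
assert (H : forall z, Cmod z < 1 -> Cder f z (epsilon (inhabits (RtoC 0)) (Cder f z))).
{ intros z Hz. now apply epsilon_spec, Hf. }
split; trivial. apply (Cder_unique f 0); trivial. apply H. rewrite Cmod_0; lra.
Qed.

(** For z other than 0 and 1, injectivity keeps c |-> h(c,z) away from the fixed values 0 and 1, and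
    [landau_crude] applies. At 0 and 1 this function is constant and V vanishes. *)
Lemma tangent_vector_bound (h : C -> sphere -> sphere) (V : C -> C) (z : C) :
  holomorphic_motion (fun _ : sphere => True) h -> normalized h -> tangent_vector h V ->
  Cmod (V z) <= 32 * (Cmod z + 1) ^ 2.
Proof.
intros Hh Hn HV.
destruct (motion_affine_coordinate h V Hh Hn HV) as [F0 [FV [Fd [Finj F01]]]].
set (F := motion_coord h) in *.
destruct (derivative_function (F z) (V z) (Fd z) (FV z)) as [df [Hdf <-]].
assert (Hm := Cmod_ge_0 z).
assert (Hconst : forall a : C, (forall c, Cmod c < 1 -> F z c = a) -> Cmod (df 0) = 0).
{ intros a Ha.
  assert (Hc : Cder (F z) 0 0).
  { apply (Cder_ext_loc (fun _ => a)); [|apply Cder_const].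
    exists 1; split; [lra|]. intros k Hk. symmetry; apply Ha.
    now replace (0 + k)%C with k by ring. }
  rewrite (Cder_unique (F z) 0 (df 0) 0); trivial; [apply Cmod_0|].
  apply Hdf. rewrite Cmod_0; lra. }
destruct (Ceq_dec z 0) as [->|Hz0].
{ rewrite (Hconst 0); [nra|]. intros c Hc. now apply F01. }
destruct (Ceq_dec z 1) as [->|Hz1].
{ rewrite (Hconst 1); [nra|]. intros c Hc. now apply F01. }
assert (HFz : F z 0 = z) by apply F0.
rewrite <- HFz at 1.
apply (landau_crude (F z) df); trivial.
intros c Hc. destruct (F01 c Hc) as [E0 E1]. split; intros E.
- apply Hz0, (Finj c); trivial. now rewrite E, E0.
- apply Hz1, (Finj c); trivial. now rewrite E, E1.
Qed.

Lemma tangent_vector_increment (h : C -> sphere -> sphere) (V : C -> C) (z1 z2 w : C) :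
  holomorphic_motion (fun _ : sphere => True) h -> normalized h -> tangent_vector h V ->
  z1 <> z2 -> Cmod (z2 - z1)%C < Cmod (w - z1)%C ->
  Cmod (V z2 - V z1)%C <= Cmod (z2 - z1)%C *
    (Cmod (V w - V z1)%C / Cmod (w - z1)%C + 128
     + 2 * ln (Cmod (w - z1)%C / Cmod (z2 - z1)%C)).
Proof.
intros Hh Hn HV H12 Hw.
destruct (motion_affine_coordinate h V Hh Hn HV) as [F0 [FV [Fd [Finj F01]]]].
set (F := motion_coord h) in *.
assert (D2 : 0 < Cmod (z2 - z1)%C).
{ apply Cmod_gt_0. intros E. apply H12. symmetry.
  replace z2 with ((z2 - z1) + z1)%C by ring. rewrite E; ring. }
assert (Hw1 : (w - z1)%C <> 0) by (apply Cmod_gt_0; lra).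
assert (Hw2 : w <> z2) by (intros ->; lra).
assert (Hwz : w <> z1) by (intros ->; apply Hw1; ring).
set (g := fun c => ((F z2 c - F z1 c) / (F w c - F z1 c))%C).
assert (Hsub : forall a b c, Cmod c < 1 -> a <> b -> (F a c - F b c)%C <> 0).
{ intros a b c Hc Hab E. apply Hab, (Finj c); trivial.
  replace (F a c) with ((F a c - F b c) + F b c)%C by ring. rewrite E; ring. }
assert (Hc0 : Cmod 0 < 1) by (rewrite Cmod_0; lra).
assert (Hg0 : g 0 = ((z2 - z1) / (w - z1))%C) by (unfold g; now rewrite !F0).
(* The quotient rule for g at c = 0. *)
set (v := (((V z2 - V z1) * (w - z1) - (z2 - z1) * (V w - V z1)) / ((w - z1) * (w - z1)))%C).
destruct (derivative_function g v) as [dg [Hdg Ev]].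
{ intros c Hc. destruct (Fd z1 c Hc) as [l1 L1]. destruct (Fd z2 c Hc) as [l2 L2].
  destruct (Fd w c Hc) as [lw Lw]. eexists.
  apply (Cder_div (fun c => F z2 c - F z1 c)%C (fun c => F w c - F z1 c)%C);
    [now apply Hsub|now apply Cder_minus; eauto|now apply Cder_minus; eauto]. }
{ unfold v.
  assert (T := Cder_div (fun c => F z2 c - F z1 c)%C (fun c => F w c - F z1 c)%C 0 _ _
    (Hsub w z1 0 Hc0 Hwz) (Cder_minus _ _ _ _ _ (FV z2) (FV z1))
    (Cder_minus _ _ _ _ _ (FV w) (FV z1))).
  cbv beta in T. rewrite !F0 in T. exact T. }
assert (Hq : Cmod (g 0) = Cmod (z2 - z1)%C / Cmod (w - z1)%C) by (rewrite Hg0; now apply Cmod_div).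
assert (Dw : 0 < Cmod (w - z1)%C) by lra.
(* By injectivity, g omits 0 because z2 differs from z1, and 1 because z2 differs from w. *)
assert (Hav : forall c, Cmod c < 1 -> g c <> 0 /\ g c <> 1).
{ intros c Hc. assert (N2 := Hsub z2 z1 c Hc (not_eq_sym H12)).
  assert (Nw := Hsub w z1 c Hc Hwz). assert (N2w := Hsub w z2 c Hc Hw2).
  split; intros E.
  - apply N2. replace (F z2 c - F z1 c)%C with (g c * (F w c - F z1 c))%C by (unfold g; field; trivial).
    rewrite E; ring.
  - apply N2w. replace (F z2 c) with (g c * (F w c - F z1 c) + F z1 c)%C by (unfold g; field; trivial).
    rewrite E; ring. }
assert (B : Cmod v <= Cmod (g 0) * (128 + 2 * ln (/ Cmod (g 0)))).
{ rewrite <- Ev. apply landau_sharp; trivial. rewrite Hq.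
  apply Rle_div_l; lra. }
rewrite Hq in B.
replace (/ (Cmod (z2 - z1)%C / Cmod (w - z1)%C)) with (Cmod (w - z1)%C / Cmod (z2 - z1)%C) in B by (field; lra).
(* The quotient rule solved for the increment of V. *)
replace (V z2 - V z1)%C with ((z2 - z1) / (w - z1) * (V w - V z1) + (w - z1) * v)%C by (unfold v; field; trivial).
eapply Rle_trans; [apply Cmod_triangle|].
rewrite !Cmod_mult, Cmod_div by trivial.
set (D := Cmod (z2 - z1)%C) in *. set (W := Cmod (w - z1)%C) in *.
apply (Rmult_le_compat_l W) in B; [|lra].
replace (W * (D / W * (128 + 2 * ln (W / D)))) with (D * (128 + 2 * ln (W / D))) in B by (field; lra).
replace (D * (Cmod (V w - V z1)%C / W + 128 + 2 * ln (W / D)))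
  with (D / W * Cmod (V w - V z1)%C + D * (128 + 2 * ln (W / D))) by (field; lra).
lra.
Qed.

Theorem theorem8 :
  forall r : R, 0 < r ->
  exists K : R,
  forall (h : C -> sphere -> sphere) (V : C -> C),
    holomorphic_motion (fun _ : sphere => True) h ->
    normalized h ->
    tangent_vector h V ->
    forall (delta : R) (z1 z2 : C),
      0 < delta < 1 ->
      z1 <> z2 ->
      Cmod z1 < r ->
      Cmod z2 < r ->
      Cmod (z1 - z2)%C < delta ->
      Cmod (V z2 - V z1)%C
        <= Cmod (z2 - z1)%C * (2 + K / ln (1 / delta))
             * ln (1 / Cmod (z2 - z1)%C).
Proof.
intros r Hr.
(* The three terms bound |V w - V z1| / |w - z1|, the constant of [landau_sharp], and 2 ln |w - z1|,
   for the w chosen below. *)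
set (K := 64 * (r + 3) ^ 2 + 128 + 2 * ln (2 * r + 2)).
exists K. intros h V Hh Hn HV delta z1 z2 Hdelta H12 Hz1 Hz2 Hdist.
rewrite Cmod_sub_sym in Hdist.
(* Far enough that |w - z1| >= 1 > delta, so the increment lemma applies, yet at a distance of at
   most 2r + 2. *)
set (w := RtoC (r + 2)).
assert (Hwm : Cmod w = r + 2) by (unfold w; rewrite Cmod_R; apply Rabs_pos_eq; lra).
assert (Hw1 : 1 <= Cmod (w - z1)%C) by (assert (T := Cmod_triangle_rev w z1); lra).
assert (Hw2 : Cmod (w - z1)%C <= 2 * r + 2).
{ unfold Cminus; eapply Rle_trans; [apply Cmod_triangle|]. rewrite Cmod_opp. lra. }
assert (D2 : 0 < Cmod (z2 - z1)%C).
{ apply Cmod_gt_0. intros E. apply H12. symmetry.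
  replace z2 with ((z2 - z1) + z1)%C by ring. rewrite E; ring. }
assert (B := tangent_vector_increment h V z1 z2 w Hh Hn HV H12 ltac:(lra)).
set (D := Cmod (z2 - z1)%C) in *. set (W := Cmod (w - z1)%C) in *.
assert (Hvar : Cmod (V w - V z1)%C / W <= 64 * (r + 3) ^ 2).
{ apply Rle_div_l; [lra|].
  assert (P := pow2_ge_0 (r + 3)).
  apply Rle_trans with (64 * (r + 3) ^ 2); [|nra].
  unfold Cminus; eapply Rle_trans; [apply Cmod_triangle|]. rewrite Cmod_opp.
  assert (B1 := tangent_vector_bound h V w Hh Hn HV).
  assert (B2 := tangent_vector_bound h V z1 Hh Hn HV).
  rewrite Hwm in B1. assert (M1 := Cmod_ge_0 z1).
  assert ((Cmod z1 + 1) ^ 2 <= (r + 3) ^ 2) by (apply pow_incr; lra).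
  replace (r + 2 + 1) with (r + 3) in B1 by ring. lra. }
assert (HlW : ln W <= ln (2 * r + 2)) by (apply ln_le; lra).
assert (HlWD : ln (W / D) = ln W + ln (1 / D)).
{ rewrite <- ln_mult; [f_equal; field; lra|lra|apply Rdiv_lt_0_compat; lra]. }
assert (Hl0 : 0 < ln (1 / delta)).
{ rewrite <- ln_1. apply ln_increasing; [lra|]. apply Rlt_div_r; lra. }
assert (HlD : ln (1 / delta) <= ln (1 / D)).
{ apply ln_le; [apply Rdiv_lt_0_compat; lra|]. unfold Rdiv. rewrite !Rmult_1_l.
  apply Rinv_le_contravar; lra. }
assert (HK : 0 <= K).
{ unfold K. assert (P := pow2_ge_0 (r + 3)).
  assert (0 <= ln (2 * r + 2)) by (rewrite <- ln_1; apply ln_le; lra). lra. }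
(* The additive constant becomes a multiple of ln (1/D), because D < delta and K is nonnegative. *)
assert (HKl : K <= K / ln (1 / delta) * ln (1 / D)).
{ replace K with (K / ln (1 / delta) * ln (1 / delta)) at 1 by (field; lra).
  apply Rmult_le_compat_l; [|trivial]. apply Rmult_le_pos; [trivial|].
  left; now apply Rinv_0_lt_compat. }
eapply Rle_trans; [exact B|]. rewrite Rmult_assoc.
apply Rmult_le_compat_l; [lra|].
rewrite HlWD. unfold K in HKl at 1. lra.
Qed.
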